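(* Let $\alpha\in(0,1)$ be an irrational number, let $\lambda\in\mathbb C$, $\lambda\ne0$, $c_0\in\mathbb C$, $c_0\ne0$, and consider the series $$u(t)=\frac{c_0\pi}{\Gamma(1-\alpha)}\sum_{n=0}^\infty\frac{\lambda^n}{\sin(\pi(n+1)\alpha)}\,\frac{t^{-n\alpha}}{\Gamma((n+1)\alpha)}$$ (the formal solution of the equation $t^{2\alpha}\left(\mathbb D^{(\alpha)}u\right)(t)=\lambda u(t)$). If $\alpha$ is poorly approximated by rational numbers, then this series converges for any $t>0$. However, this series diverges in the space of distributions $\left(\Phi_+^{1-\alpha}\right)'$.
   Context: An irrational number $\alpha\in(0,1)$ is said to be poorly approximated by rational numbers if there exist $\varepsilon>0$, $c>0$ such that for any rational number $p/q$, $p,q\in\mathbb N$, $$\left|\alpha-\frac pq\right|\ge c\,q^{-2-\varepsilon}.$$ Let $\mathcal S(0,\infty)$ be the Schwartz space of smooth functions on $[0,\infty)$ with rapid decay at infinity (together with all derivatives), with its usual topology, $$\mathcal S_+=\{\varphi\in\mathcal S(0,\infty):\ \varphi^{(l)}(0)=0,\ l=0,1,2,\ldots\},$$ $$\Phi_+^{1-\alpha}=\left\{\varphi\in\mathcal S_+:\ \int_0^\infty\varphi(x)x^{1-\alpha-k}\,dx=0,\ k=1,2,\ldots\right\},$$ with the topology induced from $\mathcal S(0,\infty)$, and let $\left(\Phi_+^{1-\alpha}\right)'$ be its dual space. A power $t^\mu$ is identified with the distribution $\varphi\mapsto\langle t^\mu,\varphi\rangle=\int_0^\infty t^\mu\varphi(t)\,dt$.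 Divergence of the series in $\left(\Phi_+^{1-\alpha}\right)'$ means that its partial sums, regarded as elements of $\left(\Phi_+^{1-\alpha}\right)'$, do not converge there, even weakly: it is not the case that for every $\varphi\in\Phi_+^{1-\alpha}$ the numerical series obtained by pairing the terms with $\varphi$ converges. Here $\mathbb D^{(\alpha)}$ is the Caputo-Dzhrbashyan fractional derivative, understood in the distribution sense on $\Phi_+^{1-\alpha}$, by $\langle\mathbb D^{(\alpha)}u,\varphi\rangle=\langle u',I_-^{1-\alpha}\varphi\rangle$ with $\left(I_-^{1-\alpha}\varphi\right)(t)=\frac1{\Gamma(1-\alpha)}\int_t^\infty(\tau-t)^{-\alpha}\varphi(\tau)\,d\tau$; the displayed series is obtained by formal termwise substitution of $\sum_{n\ge0}c_nt^{-n\alpha}$ into the equation, which gives $c_n=\lambda^n\frac{\Gamma(1-(n+1)\alpha)}{\Gamma(1-\alpha)}c_0$. *)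

(* Defs.v *)
From Stdlib Require Import Reals QArith Qreals Lra Lia.
From Coquelicot Require Import Coquelicot.
Open Scope R_scope.

Definition irrational (a : R) : Prop := forall x : Q, a <> Q2R x.

Definition poorly_approximated (a : R) : Prop :=
  exists eps c : R, 0 < eps /\ 0 < c /\
    forall p q : nat, (0 < p)%nat -> (0 < q)%nat ->
      c * Rpower (INR q) (- 2 - eps) <= Rabs (a - INR p / INR q).

Definition is_half_line_integral (f : R -> C) (l : C) : Prop :=
  is_RInt_gen (V := C_R_NormedModule) f (at_right 0) (Rbar_locally p_infty) l.

Definition half_line_integral (f : R -> C) : C :=
  RInt_gen (V := C_R_CompleteNormedModule) f
    (at_right 0) (Rbar_locally p_infty).

(* Euler's integral: the Gamma function for x > 0 only. *)
Definition Gamma (x : R) : R :=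
  RInt_gen (fun t : R => Rpower t (x - 1) * exp (- t))
    (at_right 0) (Rbar_locally p_infty).

(* A function on [0, oo) is represented by f : R -> C, whose values on
   negative arguments are irrelevant.  Differentiation is relative to
   [0, oo), hence one-sided at 0; [is_derive] is the same with [locally x]. *)
Definition is_half_line_derive (f : R -> C) (x : R) (l : C) : Prop :=
  filterdiff (K := R_AbsRing) (U := R_NormedModule) (V := C_R_NormedModule)
    f (within (Rle 0) (locally x)) (fun y : R => scal y l).

Definition ex_half_line_derive (f : R -> C) (x : R) : Prop :=
  exists l : C, is_half_line_derive f x l.

Definition half_line_derive (f : R -> C) (x : R) : C :=
  iota (T := C_R_CompleteNormedModule)
    (fun l : C => is_half_line_derive f x l).

Fixpoint half_line_derive_n (n : nat) (f : R -> C) : R -> C :=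
  match n with
  | O => f
  | S n => half_line_derive (half_line_derive_n n f)
  end.

Definition schwartz (f : R -> C) : Prop :=
  (forall (l : nat) (x : R), 0 <= x ->
     ex_half_line_derive (half_line_derive_n l f) x) /\
  (forall k l : nat, exists M : R, forall x : R, 0 <= x ->
     x ^ k * Cmod (half_line_derive_n l f x) <= M).

(* sup over x >= 0 of x^k |f^(l)(x)|; this is finite for Schwartz f. *)
Definition seminorm (k l : nat) (f : R -> C) : R :=
  real (Lub_Rbar (fun r : R => exists x : R,
    0 <= x /\ r = x ^ k * Cmod (half_line_derive_n l f x))).

Definition S_plus (f : R -> C) : Prop :=
  schwartz f /\ forall l : nat, half_line_derive_n l f 0 = RtoC 0.

Definition Phi_plus (beta : R) (f : R -> C) : Prop :=
  S_plus f /\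
  forall k : nat, (1 <= k)%nat ->
    is_half_line_integral
      (fun x : R => Cmult (f x) (RtoC (Rpower x (beta - INR k)))) (RtoC 0).

Record test_function (beta : R) : Type := Test_function {
  test_fun :> R -> C;
  test_funP : Phi_plus beta test_fun
}.

(* Linearity is stated up to equality on [0, oo); in particular the functional
   does not see the irrelevant values on negative arguments. *)
Definition linear_functional (beta : R) (T : test_function beta -> C) : Prop :=
  forall (a b : C) (f g h : test_function beta),
    (forall x : R, 0 <= x -> h x = Cplus (Cmult a (f x)) (Cmult b (g x))) ->
    T h = Cplus (Cmult a (T f)) (Cmult b (T g)).

(* Continuity for the topology induced by the seminorms: the sets
   {g | seminorm k l (g - f) < delta for all k, l <= N} are a basis of
   neighbourhoods of f. *)
Definition continuous_functional (beta : R) (T : test_function beta -> C)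
    : Prop :=
  forall (f : test_function beta) (eps : R), 0 < eps ->
    exists (N : nat) (delta : R), 0 < delta /\
      forall g : test_function beta,
        (forall k l : nat, (k <= N)%nat -> (l <= N)%nat ->
           seminorm k l (fun x : R => Cminus (g x) (f x)) < delta) ->
        Cmod (Cminus (T g) (T f)) < eps.

Record distribution (beta : R) : Type := Distribution {
  pairing :> test_function beta -> C;
  pairing_linear : linear_functional beta pairing;
  pairing_continuous : continuous_functional beta pairing
}.

Lemma linear_functional_plus (beta : R) (T U : distribution beta) :
  linear_functional beta (fun phi => Cplus (T phi) (U phi)).
Proof.
intros a b f g h H.
rewrite (pairing_linear _ T a b f g h H), (pairing_linear _ U a b f g h H).
ring.
Qed.

Lemma continuous_functional_plus (beta : R) (T U : distribution beta) :
  continuous_functional beta (fun phi => Cplus (T phi) (U phi)).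
Proof.
intros f eps He.
destruct (pairing_continuous _ T f (eps / 2)) as [N1 [d1 [Hd1 H1]]]; [lra|].
destruct (pairing_continuous _ U f (eps / 2)) as [N2 [d2 [Hd2 H2]]]; [lra|].
exists (max N1 N2), (Rmin d1 d2); split; [now apply Rmin_pos|].
intros g Hg.
replace (Cminus _ _) with
  (Cplus (Cminus (T g) (T f)) (Cminus (U g) (U f))) by ring.
eapply Rle_lt_trans; [apply Cmod_triangle|].
assert (Cmod (Cminus (T g) (T f)) < eps / 2).
{ apply H1; intros k l Hk Hl.
  apply Rlt_le_trans with (2 := Rmin_l d1 d2), Hg; lia. }
assert (Cmod (Cminus (U g) (U f)) < eps / 2).
{ apply H2; intros k l Hk Hl.
  apply Rlt_le_trans with (2 := Rmin_r d1 d2), Hg; lia. }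
lra.
Qed.

Definition dist_plus (beta : R) (T U : distribution beta) : distribution beta :=
  Distribution beta (fun phi => Cplus (T phi) (U phi))
    (linear_functional_plus beta T U) (continuous_functional_plus beta T U).

Lemma linear_functional_scal (beta : R) (c : C) (T : distribution beta) :
  linear_functional beta (fun phi => Cmult c (T phi)).
Proof.
intros a b f g h H; rewrite (pairing_linear _ T a b f g h H); ring.
Qed.

Lemma continuous_functional_scal (beta : R) (c : C) (T : distribution beta) :
  continuous_functional beta (fun phi => Cmult c (T phi)).
Proof.
intros f eps He.
assert (Hc := Cmod_ge_0 c).
destruct (pairing_continuous _ T f (eps / (Cmod c + 1))) as [N [d [Hd H]]].
{ apply Rdiv_lt_0_compat; lra. }
exists N, d; split; [easy|]; intros g Hg.
replace (Cminus _ _) with (Cmult c (Cminus (T g) (T f))) by ring.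
rewrite Cmod_mult.
assert (H' := H g Hg); assert (Hp := Cmod_ge_0 (Cminus (T g) (T f))).
apply Rmult_lt_compat_r with (r := Cmod c + 1) in H'; [|lra].
replace (eps / (Cmod c + 1) * (Cmod c + 1)) with eps in H' by (field; lra).
nra.
Qed.

Definition dist_scal (beta : R) (c : C) (T : distribution beta)
    : distribution beta :=
  Distribution beta (fun phi => Cmult c (T phi))
    (linear_functional_scal beta c T) (continuous_functional_scal beta c T).

Fixpoint dist_partial_sum (beta : R) (T : nat -> distribution beta) (n : nat)
    : distribution beta :=
  match n with
  | O => T O
  | S n => dist_plus beta (dist_partial_sum beta T n) (T (S n))
  end.

Definition dist_series_converges_weakly (beta : R)
    (T : nat -> distribution beta) : Prop :=
  forall phi : test_function beta,
    exists l : C,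
      filterlim (fun n : nat => dist_partial_sum beta T n phi)
        eventually (locally (T := C_UniformSpace) l).

Definition power_pairing (mu : R) (f : R -> C) : C :=
  half_line_integral (fun t : R => Cmult (RtoC (Rpower t mu)) (f t)).

Lemma within_half_line_proper (x : R) : 0 <= x ->
  ProperFilter (within (Rle 0) (locally x)).
Proof.
intros Hx; split; [|apply within_filter, locally_filter].
intros P HP; exists x.
exact (locally_singleton x _ HP Hx).
Qed.

Lemma within_half_line_lim (x : R) :
  is_filter_lim (T := R_UniformSpace) (within (Rle 0) (locally x)) x.
Proof.
intros P HP; apply filter_le_within; exact HP.
Qed.

Lemma Cmod_norm (z : C) : norm (V := C_R_NormedModule) z = Cmod z.
Proof.
unfold Cmod, norm; simpl; unfold prod_norm, norm; simpl; unfold abs; simpl.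
f_equal; rewrite !Rmult_1_r, <- !Rabs_mult, !Rabs_pos_eq; try ring; nra.
Qed.

Lemma is_half_line_derive_unique (f : R -> C) (x : R) (l1 l2 : C) : 0 <= x ->
  is_half_line_derive f x l1 -> is_half_line_derive f x l2 -> l1 = l2.
Proof.
intros Hx H1 H2.
assert (FF := within_half_line_proper x Hx).
assert (H := filterdiff_minus_fct _ _ _ _ H1 H2).
destruct H as [_ H]; specialize (H x (within_half_line_lim x)).
destruct (Ceq_dec l1 l2) as [e|n]; [exact e|exfalso].
assert (Hn : 0 < Cmod (Cminus l1 l2)).
{ apply Cmod_gt_0; intros E; apply n.
  replace l1 with (Cplus (Cminus l1 l2) l2) by ring; rewrite E; ring. }
assert (He : 0 < Cmod (Cminus l1 l2) / 2) by lra.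
destruct (H (mkposreal _ He)) as [d Hd].
assert (Hdp := cond_pos d).
specialize (Hd (x + d / 2)).
assert (B : ball x d (x + d / 2)).
{ unfold ball; simpl; unfold AbsRing_ball, abs, minus, plus, opp; simpl.
  rewrite Rabs_pos_eq; lra. }
assert (X : 0 <= x + d / 2) by lra.
specialize (Hd B X); simpl in Hd.
replace (minus (minus (minus _ _) _) _) with
  (scal (- (d / 2)) (Cminus l1 l2) : C_R_NormedModule) in Hd.
- rewrite Cmod_norm, scal_R_Cmult, Cmod_mult, Cmod_R in Hd.
  rewrite Rabs_Ropp, Rabs_pos_eq in Hd by lra.
  unfold norm, minus, plus, opp in Hd; simpl in Hd; unfold abs in Hd.
  simpl in Hd; rewrite Rabs_pos_eq in Hd by lra; nra.
- apply injective_projections; unfold minus, plus, opp, scal; simpl;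
    unfold mult; simpl; unfold prod_plus, prod_opp, prod_scal, plus, opp, scal;
    simpl; unfold mult; simpl; ring.
Qed.

Lemma half_line_derive_eq (f : R -> C) (x : R) (l : C) : 0 <= x ->
  is_half_line_derive f x l -> half_line_derive f x = l.
Proof.
intros Hx H; unfold half_line_derive.
apply (iota_unique (V := C_R_CompleteNormedModule)); [|exact H].
intros y Hy; exact (is_half_line_derive_unique f x y l Hx Hy H).
Qed.

Lemma half_line_derive_correct (f : R -> C) (x : R) : 0 <= x ->
  ex_half_line_derive f x -> is_half_line_derive f x (half_line_derive f x).
Proof.
intros Hx [l H]; rewrite (half_line_derive_eq f x l Hx H); exact H.
Qed.

Lemma is_half_line_derive_ext (f g : R -> C) (x : R) (l : C) : 0 <= x ->
  (forall y : R, 0 <= y -> f y = g y) ->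
  is_half_line_derive f x l -> is_half_line_derive g x l.
Proof.
intros Hx E; assert (FF := within_half_line_proper x Hx).
apply filterdiff_ext_loc.
- exists (mkposreal 1 Rlt_0_1); intros y _ Hy; exact (E y Hy).
- intros y Hy.
  rewrite (is_filter_lim_unique (V := R_NormedModule) _ _ Hy
             (within_half_line_lim x)).
  exact (E x Hx).
Qed.

Lemma is_half_line_derive_minus (f g : R -> C) (x : R) (lf lg : C) : 0 <= x ->
  is_half_line_derive f x lf -> is_half_line_derive g x lg ->
  is_half_line_derive (fun y => Cminus (f y) (g y)) x (Cminus lf lg).
Proof.
intros Hx Hf Hg; assert (FF := within_half_line_proper x Hx).
eapply filterdiff_ext_lin; [exact (filterdiff_minus_fct _ _ _ _ Hf Hg)|].
intros y; simpl.
rewrite !scal_R_Cmult; change minus with Cminus; ring.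
Qed.

Lemma is_half_line_derive_interior (f : R -> C) (x : R) (l : C) : 0 < x ->
  is_half_line_derive f x l -> is_derive (V := C_R_NormedModule) f x l.
Proof.
intros Hx [L H]; split; [exact L|].
intros y Hy eps.
assert (E := is_filter_lim_locally_unique (V := R_NormedModule) x y Hy).
subst y; specialize (H x (within_half_line_lim x) eps).
destruct H as [d Hd].
assert (Hm : 0 < Rmin d x) by (apply Rmin_pos; [apply cond_pos | exact Hx]).
exists (mkposreal _ Hm); intros y By; apply Hd.
- apply Rlt_le_trans with (1 := By), Rmin_l.
- assert (B : Rabs (y - x) < x)
    by (apply Rlt_le_trans with (1 := By), Rmin_r).
  apply Rabs_def2 in B; lra.
Qed.

Lemma continuous_half_line_derive (f : R -> C) (x : R) : 0 <= x ->
  ex_half_line_derive f x ->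
  continuous (U := C_UniformSpace) (fun y => f (Rabs y)) x.
Proof.
intros Hx [l H]; assert (FF := within_half_line_proper x Hx).
assert (L : filterlim f (within (Rle 0) (locally x))
              (locally (T := C_UniformSpace) (f x))).
{ apply (filterdiff_continuous_aux (U := R_NormedModule)
    (V := C_R_NormedModule)); [|apply within_half_line_lim].
  eexists; exact H. }
unfold continuous; rewrite (Rabs_pos_eq x Hx).
apply filterlim_comp with (2 := L).
intros P HP; unfold filtermap.
assert (A := continuous_Rabs x); unfold continuous in A.
rewrite (Rabs_pos_eq x Hx) in A.
specialize (A _ HP); unfold filtermap in A; revert A.
apply filter_imp; intros y Hy; apply Hy, Rabs_pos.
Qed.

Lemma half_line_mean_value (f : R -> C) (t M : R) : 0 < t ->
  (forall s : R, 0 <= s <= t -> ex_half_line_derive f s) ->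
  (forall s : R, 0 <= s <= t -> Cmod (half_line_derive f s) <= M) ->
  f 0 = RtoC 0 -> Cmod (f t) <= 2 * M * t.
Proof.
intros Ht Hd HM H0.
assert (P : forall pr : C_R_NormedModule -> R_NormedModule, is_linear pr ->
  (forall z : C, Rabs (pr z) <= Cmod z) -> pr (RtoC 0) = 0 ->
  Rabs (pr (f t)) <= M * t).
{ intros pr Lp Hp Hp0.
  destruct (MVT_gen (fun y => pr (f (Rabs y))) 0 t
    (fun y => pr (half_line_derive f y))) as [c [Hc E]].
  - rewrite Rmin_left, Rmax_right by lra; intros x Hx.
    apply (is_derive_ext_loc (fun y => pr (f y))).
    + exists (mkposreal x (proj1 Hx)); intros y By; simpl in By.
      assert (B : Rabs (y - x) < x) by exact By.
      apply Rabs_def2 in B; rewrite Rabs_pos_eq; [easy|lra].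
    + assert (D : is_derive (V := C_R_NormedModule) f x (half_line_derive f x)).
      { apply is_half_line_derive_interior; [lra|].
        apply half_line_derive_correct; [|apply Hd]; lra. }
      assert (D' := filterdiff_comp' f pr x _ pr D (filterdiff_linear pr Lp)).
      eapply filterdiff_ext_lin; [exact D'|].
      intros y; apply (linear_scal pr Lp).
  - rewrite Rmin_left, Rmax_right by lra; intros x Hx.
    apply continuity_pt_filterlim.
    apply (continuous_comp (fun y => f (Rabs y)) pr).
    + apply continuous_half_line_derive; [|apply Hd]; lra.
    + apply (linear_cont pr _ Lp).
  - rewrite Rmin_left, Rmax_right in Hc by lra.
    rewrite Rabs_R0, H0, Hp0, Rabs_pos_eq in E by lra.
    replace (pr (f t)) with (pr (half_line_derive f c) * t)
      by (simpl in *; lra).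
    rewrite Rabs_mult, (Rabs_pos_eq t) by lra.
    apply Rmult_le_compat_r; [lra|].
    eapply Rle_trans; [apply Hp|apply HM, Hc]. }
assert (P1 := P fst (is_linear_fst (U := R_NormedModule) (V := R_NormedModule))
  (fun z => Rle_trans _ _ _ (Rmax_l _ _) (Rmax_Cmod z)) eq_refl).
assert (P2 := P snd (is_linear_snd (U := R_NormedModule) (V := R_NormedModule))
  (fun z => Rle_trans _ _ _ (Rmax_r _ _) (Rmax_Cmod z)) eq_refl).
eapply Rle_trans; [apply Cmod_2Rmax|].
assert (sqrt 2 <= 2).
{ rewrite <- (sqrt_square 2) at 2 by lra; apply sqrt_le_1; lra. }
assert (S0 := sqrt_pos 2).
assert (Rmax (Rabs (fst (f t))) (Rabs (snd (f t))) <= M * t)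
  by (apply Rmax_lub; assumption).
assert (H2 := Rle_trans _ _ _ (Rabs_pos (fst (f t)))
  (Rmax_l (Rabs (fst (f t))) (Rabs (snd (f t))))).
nra.
Qed.

Lemma schwartz_minus (f g : R -> C) : schwartz f -> schwartz g ->
  forall (l : nat) (x : R), 0 <= x ->
  half_line_derive_n l (fun y => Cminus (f y) (g y)) x =
    Cminus (half_line_derive_n l f x) (half_line_derive_n l g x) /\
  ex_half_line_derive
    (half_line_derive_n l (fun y => Cminus (f y) (g y))) x.
Proof.
intros [Hf _] [Hg _].
assert (K : forall l x, 0 <= x -> is_half_line_derive
  (fun y => Cminus (half_line_derive_n l f y) (half_line_derive_n l g y)) x
  (Cminus (half_line_derive_n (S l) f x) (half_line_derive_n (S l) g x))).
{ intros l x Hx; apply is_half_line_derive_minus; [exact Hx| |];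
    apply half_line_derive_correct; auto. }
assert (E : forall l x, 0 <= x ->
  half_line_derive_n l (fun y => Cminus (f y) (g y)) x =
  Cminus (half_line_derive_n l f x) (half_line_derive_n l g x)).
{ induction l as [|l IH]; intros x Hx; [easy|].
  apply half_line_derive_eq; [exact Hx|].
  refine (is_half_line_derive_ext _ _ x _ Hx _ (K l x Hx)).
  intros y Hy; symmetry; exact (IH y Hy). }
intros l x Hx; split; [exact (E l x Hx)|]; eexists.
refine (is_half_line_derive_ext _ _ x _ Hx _ (K l x Hx)).
intros y Hy; symmetry; exact (E l y Hy).
Qed.

Lemma S_plus_minus (f g : R -> C) : S_plus f -> S_plus g ->
  S_plus (fun y => Cminus (f y) (g y)).
Proof.
intros [Hf Hf0] [Hg Hg0].
assert (H := schwartz_minus f g Hf Hg).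
split; [split|].
- intros l x Hx; apply H, Hx.
- intros k l.
  destruct (proj2 Hf k l) as [M HM], (proj2 Hg k l) as [M' HM'].
  exists (M + M'); intros x Hx.
  rewrite (proj1 (H l x Hx)).
  assert (T : Cmod (Cminus (half_line_derive_n l f x)
     (half_line_derive_n l g x)) <=
    Cmod (half_line_derive_n l f x) + Cmod (half_line_derive_n l g x)).
  { unfold Cminus; rewrite <- (Cmod_opp (half_line_derive_n l g x)).
    apply Cmod_triangle. }
  specialize (HM x Hx); specialize (HM' x Hx).
  assert (Hk := pow_le x k Hx).
  apply Rle_trans with (x ^ k * (Cmod (half_line_derive_n l f x) +
    Cmod (half_line_derive_n l g x))); [|lra].
  apply Rmult_le_compat_l; assumption.
- intros l; rewrite (proj1 (H l 0 (Rle_refl 0))), Hf0, Hg0; ring.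
Qed.

Lemma seminorm_ub (k l : nat) (f : R -> C) (x : R) : schwartz f -> 0 <= x ->
  x ^ k * Cmod (half_line_derive_n l f x) <= seminorm k l f.
Proof.
intros [_ Hf] Hx; unfold seminorm.
set (E := fun r : R => _).
assert (HE : E (x ^ k * Cmod (half_line_derive_n l f x)))
  by (exists x; split; [exact Hx|reflexivity]).
destruct (Lub_Rbar_correct E) as [U L].
specialize (U _ HE).
destruct (Hf k l) as [M HM].
assert (B : Rbar_le (Lub_Rbar E) (Finite M)).
{ apply L; intros r [y [Hy ->]]; exact (HM y Hy). }
destruct (Lub_Rbar E) as [r| |]; simpl in *; tauto.
Qed.

Lemma S_plus_flat (f : R -> C) (N : nat) (t : R) : S_plus f -> 0 <= t ->
  Cmod (f t) <= 2 ^ N * t ^ N * seminorm 0 N f.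
Proof.
intros [Hf H0] Ht.
assert (G : forall n, (n <= N)%nat -> forall t, 0 <= t ->
  Cmod (half_line_derive_n (N - n) f t) <= 2 ^ n * t ^ n * seminorm 0 N f).
{ induction n as [|n IH]; intros Hn s Hs.
  - assert (Q := seminorm_ub 0 N f s Hf Hs).
    rewrite Nat.sub_0_r; simpl in *; lra.
  - assert (Pp : 0 <= seminorm 0 N f).
    { assert (Q := seminorm_ub 0 N f 0 Hf (Rle_refl 0)); simpl in Q.
      assert (Q' := Cmod_ge_0 (half_line_derive_n N f 0)); lra. }
    destruct (Req_dec s 0) as [->|Hs0].
    { rewrite H0, Cmod_0, (pow_i (S n)) by lia; lra. }
    replace (2 ^ S n * s ^ S n * seminorm 0 N f) with
      (2 * (2 ^ n * s ^ n * seminorm 0 N f) * s) by (simpl; ring).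
    apply half_line_mean_value; [lra| | |apply H0].
    + intros r Hr; apply (proj1 Hf); lra.
    + intros r Hr.
      change (half_line_derive _ r) with
        (half_line_derive_n (S (N - S n)) f r).
      replace (S (N - S n)) with (N - n)%nat by lia.
      eapply Rle_trans; [apply IH; [lia|lra]|].
      apply Rmult_le_compat_r; [exact Pp|].
      apply Rmult_le_compat_l; [apply pow_le; lra|].
      apply pow_incr; lra. }
specialize (G N (le_n N) t Ht); now rewrite Nat.sub_diag in G.
Qed.

Lemma half_line_integral_dominated (f : R -> C) (A B : R) :
  (forall t : R, 0 < t -> continuous (U := C_UniformSpace) f t) ->
  (forall t : R, 0 < t <= 1 -> Cmod (f t) <= A) ->
  (forall t : R, 1 <= t -> t ^ 2 * Cmod (f t) <= B) ->
  is_half_line_integral f (half_line_integral f) /\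
  Cmod (half_line_integral f) <= A + B.
Proof.
intros Cf HA HB.
assert (A0 : 0 <= A).
{ eapply Rle_trans; [apply (Cmod_ge_0 (f 1))|apply HA; lra]. }
assert (B0 : 0 <= B).
{ eapply Rle_trans; [|apply (HB 1); lra]; assert (H := Cmod_ge_0 (f 1)); nra. }
assert (Ex : forall a b, 0 < a -> 0 < b ->
  ex_RInt (V := C_R_CompleteNormedModule) f a b).
{ intros a b Ha Hb; apply ex_RInt_continuous; intros z Hz; apply Cf.
  assert (0 < Rmin a b) by now apply Rmin_pos.
  lra. }
assert (Near : forall a b l, 0 < a <= 1 -> 0 < b <= 1 ->
  is_RInt (V := C_R_NormedModule) f a b l -> Cmod l <= Rabs (b - a) * A).
{ intros a b l Ha Hb Hl; rewrite <- Cmod_norm.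
  apply (norm_RInt_le_const_abs f a b l A); [|exact Hl].
  intros x Hx; rewrite Cmod_norm; apply HA.
  assert (0 < Rmin a b) by now apply Rmin_pos.
  assert (Rmax a b <= 1) by now apply Rmax_lub.
  lra. }
assert (Far : forall a b l, 1 <= a <= b ->
  is_RInt (V := C_R_NormedModule) f a b l -> Cmod l <= B * / a).
{ intros a b l Hab Hl.
  assert (Hb : 0 < / b) by (apply Rinv_0_lt_compat; lra).
  apply Rle_trans with (B * (/ a - / b)); [|nra].
  rewrite <- Cmod_norm.
  apply (norm_RInt_le f (fun x => B / x ^ 2) a b l); [lra| |exact Hl|].
  - intros x Hx; rewrite Cmod_norm.
    apply Rmult_le_reg_l with (x ^ 2); [nra|].
    replace (x ^ 2 * (B / x ^ 2)) with B by (field; lra).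
    apply HB; lra.
  - replace (B * (/ a - / b)) with (minus (- B / b) (- B / a))
      by (unfold minus, plus, opp; simpl; field; lra).
    apply (is_RInt_derive (fun x => - B / x)).
    + rewrite Rmin_left, Rmax_right by lra; intros x Hx.
      auto_derive; [lra|field; lra].
    + rewrite Rmin_left, Rmax_right by lra; intros x Hx.
      apply (ex_derive_continuous (fun x => B / x ^ 2)).
      auto_derive; nra. }
assert (PF : ProperFilter (filter_prod (at_right 0) (Rbar_locally p_infty))).
{ apply filter_prod_proper. }
assert (XI : ex_RInt_gen (V := C_R_CompleteNormedModule) f
  (at_right 0) (Rbar_locally p_infty)).
{ apply (filterlimi_locally_cauchy (U := C_R_CompleteNormedModule)).
  - apply Filter_prod with (fun a => 0 < a) (fun b => 1 < b).
    + exists (mkposreal 1 Rlt_0_1); intros y _ Hy; exact Hy.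
    + exists 1; easy.
    + intros a b Ha Hb; simpl; split; [apply Ex; lra|].
      intros y1 y2 H1 H2.
      rewrite <- (is_RInt_unique _ _ _ _ H1).
      exact (is_RInt_unique _ _ _ _ H2).
  - intros eps; assert (He := cond_pos eps).
    set (d := eps / (2 * (A + B + 1))).
    assert (Hd : 0 < d) by (apply Rdiv_lt_0_compat; lra).
    assert (Hm : 0 < Rmin 1 d) by (apply Rmin_pos; lra).
    assert (Hm1 := Rmin_l 1 d); assert (Hm2 := Rmin_r 1 d).
    set (m := Rmin 1 d) in *.
    assert (HmE : m * (A + B) < eps).
    { apply Rle_lt_trans with (d * (A + B)); [apply Rmult_le_compat_r; lra|].
      apply Rmult_lt_reg_r with (2 * (A + B + 1)); [lra|].
      replace (d * (A + B) * (2 * (A + B + 1))) with (eps * (A + B))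
        by (unfold d; field; lra).
      nra. }
    assert (Hi : 1 <= / m) by (rewrite <- Rinv_1; apply Rinv_le_contravar; lra).
    exists (fun ab => 0 < fst ab < m /\ / m < snd ab); split.
    { apply Filter_prod with (fun a => 0 < a < m) (fun b => / m < b).
      + exists (mkposreal m Hm); intros y By Hy.
        assert (R : Rabs (y - 0) < m) by exact By.
        apply Rabs_def2 in R; lra.
      + exists (/ m); easy.
      + easy. }
    assert (W : forall a b a' b' l l', 0 < a < m -> 0 < a' < m ->
      / m < b -> / m < b' -> b <= b' ->
      is_RInt (V := C_R_NormedModule) f a b l ->
      is_RInt (V := C_R_NormedModule) f a' b' l' ->
      Cmod (Cminus l' l) < eps).
    { intros a b a' b' l l' Ha Ha' Hb Hb' Hbb Hl Hl'.
      destruct (Ex a' a) as [u Hu]; [lra|lra|].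
      destruct (Ex b b') as [v Hv]; [lra|lra|].
      assert (S := is_RInt_Chasles _ _ _ _ _ _
        (is_RInt_Chasles _ _ _ _ _ _ Hu Hl) Hv).
      assert (E : l' = Cplus (Cplus u l) v).
      { rewrite <- (is_RInt_unique (V := C_R_CompleteNormedModule) _ _ _ _ Hl').
        exact (is_RInt_unique (V := C_R_CompleteNormedModule) _ _ _ _ S). }
      replace (Cminus l' l) with (Cplus u v) by (rewrite E; ring).
      eapply Rle_lt_trans; [apply Cmod_triangle|].
      assert (U1 : Cmod u <= Rabs (a - a') * A) by (apply Near; try lra; easy).
      assert (V1 : Cmod v <= B * / b) by (apply (Far b b'); try lra; easy).
      assert (U2 : Rabs (a - a') <= m) by (apply Rabs_le; lra).
      assert (V2 : / b <= m).
      { rewrite <- (Rinv_inv m); apply Rinv_le_contravar; [|lra].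
        apply Rinv_0_lt_compat; lra. }
      assert (Q1 := Rmult_le_compat_r A _ _ A0 U2).
      assert (Q2 := Rmult_le_compat_l B _ _ B0 V2).
      lra. }
    intros [a b] [a' b'] [Ha Hb] [Ha' Hb'] l l' Hl Hl'; simpl in *.
    apply (norm_compat1 (V := C_R_NormedModule)).
    change (minus l' l) with (Cminus l' l); rewrite Cmod_norm.
    destruct (Rle_dec b b') as [Hbb|Hbb].
    + apply (W a b a' b'); easy.
    + rewrite <- Cmod_opp; replace (Copp _) with (Cminus l l') by ring.
      apply (W a' b' a b); try easy; lra. }
assert (I : is_half_line_integral f (half_line_integral f)).
{ exact (RInt_gen_correct (V := C_R_CompleteNormedModule) f XI). }
split; [exact I|].
apply le_epsilon; intros eps He.
set (nf := @norm_factor R_AbsRing C_R_NormedModule).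
assert (Hnf : 0 < nf) by apply norm_factor_gt_0.
assert (He' : 0 < eps / nf) by now apply Rdiv_lt_0_compat.
assert (F := I _ (locally_ball (T := C_R_NormedModule) (half_line_integral f)
  (mkposreal _ He'))).
unfold filtermapi in F.
assert (F' : filter_prod (at_right 0) (Rbar_locally p_infty)
  (fun ab : R * R => 0 < fst ab < 1 /\ 1 < snd ab)).
{ apply Filter_prod with (fun a => 0 < a < 1) (fun b => 1 < b).
  + exists (mkposreal 1 Rlt_0_1); intros y By Hy.
    assert (R : Rabs (y - 0) < 1) by exact By.
    apply Rabs_def2 in R; lra.
  + exists 1; easy.
  + easy. }
destruct (filter_ex _ (filter_and _ _ F F')) as [[a b] [[l [Hl Bl]] [Ha Hb]]].
simpl in *.
apply (norm_compat2 (V := C_R_NormedModule) _ _ (mkposreal _ He')) in Bl.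
fold nf in Bl; simpl in Bl.
replace (nf * (eps / nf)) with eps in Bl by (field; lra).
change (minus l (half_line_integral f)) with
  (Cminus l (half_line_integral f)) in Bl.
rewrite Cmod_norm in Bl.
destruct (Ex a 1) as [u Hu]; [lra|lra|].
destruct (Ex 1 b) as [v Hv]; [lra|lra|].
assert (E : l = Cplus u v).
{ rewrite <- (is_RInt_unique (V := C_R_CompleteNormedModule) _ _ _ _ Hl).
  apply (is_RInt_unique (V := C_R_CompleteNormedModule)).
  exact (is_RInt_Chasles _ _ _ _ _ _ Hu Hv). }
assert (U1 : Cmod u <= Rabs (1 - a) * A) by (apply Near; try lra; easy).
assert (V1 : Cmod v <= B * / 1) by (apply (Far 1 b); try lra; easy).
rewrite Rabs_pos_eq in U1 by lra; rewrite Rinv_1 in V1.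
assert (T1 := Cmod_triangle u v); rewrite <- E in T1.
assert (T2 := Cmod_triangle l (Copp (Cminus l (half_line_integral f)))).
rewrite Cmod_opp in T2.
replace (Cplus l (Copp (Cminus l (half_line_integral f)))) with
  (half_line_integral f) in T2 by ring.
nra.
Qed.

Lemma half_line_integral_unique (f : R -> C) (l : C) :
  is_half_line_integral f l -> half_line_integral f = l.
Proof.
exact (is_RInt_gen_unique (V := C_R_CompleteNormedModule) f l).
Qed.

Lemma is_half_line_integral_ext (f g : R -> C) (l : C) :
  (forall t : R, 0 < t -> f t = g t) ->
  is_half_line_integral f l -> is_half_line_integral g l.
Proof.
intros E; apply is_RInt_gen_ext.
apply Filter_prod with (fun a => 0 < a) (fun b => 0 < b).
- exists (mkposreal 1 Rlt_0_1); intros y _ Hy; exact Hy.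
- exists 0; easy.
- intros a b Ha Hb x Hx; apply E; simpl in Hx.
  assert (0 < Rmin a b) by now apply Rmin_pos.
  lra.
Qed.

Lemma is_linear_Cmult (c : C) :
  is_linear (K := R_AbsRing) (U := C_R_NormedModule) (V := C_R_NormedModule)
    (Cmult c).
Proof.
split.
- intros x y; exact (Cmult_plus_distr_l c x y).
- intros k x; rewrite !scal_R_Cmult.
  change (Cmult c (Cmult k x) = Cmult k (Cmult c x)); ring.
- exists (Cmod c + 1); assert (H := Cmod_ge_0 c); split; [lra|].
  intros x; rewrite !Cmod_norm, Cmod_mult.
  assert (H' := Cmod_ge_0 x); nra.
Qed.

Lemma is_RInt_Cmult (c : C) (f : R -> C) (a b : R) (l : C) :
  is_RInt (V := C_R_NormedModule) f a b l ->
  is_RInt (V := C_R_NormedModule) (fun t => Cmult c (f t)) a b (Cmult c l).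
Proof.
intros H; assert (H1 := is_RInt_fct_extend_fst _ _ _ _ H).
assert (H2 := is_RInt_fct_extend_snd _ _ _ _ H).
apply is_RInt_fct_extend_pair; simpl.
- apply (is_RInt_minus (V := R_NormedModule));
    apply (is_RInt_scal (V := R_NormedModule)); assumption.
- apply (is_RInt_plus (V := R_NormedModule));
    apply (is_RInt_scal (V := R_NormedModule)); assumption.
Qed.

Lemma is_half_line_integral_Cmult (c : C) (f : R -> C) (l : C) :
  is_half_line_integral f l ->
  is_half_line_integral (fun t => Cmult c (f t)) (Cmult c l).
Proof.
intros H P HP.
assert (L := linear_cont (K := R_AbsRing) (U := C_R_NormedModule)
  (V := C_R_NormedModule) (Cmult c) l (is_linear_Cmult c)).
specialize (H _ (L P HP)); revert H.
unfold filtermapi; apply filter_imp; intros ab [y [Hy Py]].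
exists (Cmult c y); split; [now apply is_RInt_Cmult|exact Py].
Qed.

Lemma Rpower_le_exponent (t x y : R) : 1 <= t -> x <= y ->
  Rpower t x <= Rpower t y.
Proof.
intros [Ht| <-] Hxy.
- apply Rle_Rpower; lra.
- unfold Rpower; rewrite ln_1, !Rmult_0_r; lra.
Qed.

Lemma power_pairing_bound (mu : R) : exists N K : nat, forall f : R -> C,
  S_plus f ->
  is_half_line_integral (fun t : R => Cmult (RtoC (Rpower t mu)) (f t))
    (power_pairing mu f) /\
  Cmod (power_pairing mu f) <= 2 ^ N * seminorm 0 N f + seminorm K 0 f.
Proof.
destruct (INR_unbounded (- mu)) as [N HN].
destruct (INR_unbounded (mu + 2)) as [K HK].
exists N, K; intros f Hf.
assert (HP : forall t, Cmod (RtoC (Rpower t mu)) = Rpower t mu).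
{ intros t; rewrite Cmod_R; apply Rabs_pos_eq, Rlt_le, exp_pos. }
apply half_line_integral_dominated.
- intros t Ht.
  apply (continuous_ext (fun t => scal (Rpower t mu) (f t : C_R_NormedModule))).
  { intros x; apply scal_R_Cmult. }
  apply (continuous_scal (V := C_R_NormedModule)).
  + apply (ex_derive_continuous (fun t => Rpower t mu)).
    unfold Rpower; auto_derive; exact Ht.
  + apply (ex_derive_continuous (V := C_R_NormedModule)).
    destruct (proj1 (proj1 Hf) O t (Rlt_le _ _ Ht)) as [l Hl].
    exists l; now apply is_half_line_derive_interior.
- intros t Ht; rewrite Cmod_mult, HP.
  assert (B := S_plus_flat f N t Hf (Rlt_le _ _ (proj1 Ht))).
  assert (Q : Rpower t mu * t ^ N <= 1).
  { rewrite <- Rpower_pow, <- Rpower_plus by easy.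
    unfold Rpower; rewrite <- exp_0.
    assert (L : ln t <= 0) by (rewrite <- ln_1; apply ln_le; lra).
    assert (M : (mu + INR N) * ln t <= 0) by nra.
    destruct M as [M|M]; [left; now apply exp_increasing|right; now rewrite M]. }
  assert (P0 : 0 < Rpower t mu) by apply exp_pos.
  assert (S0 : 0 <= 2 ^ N * seminorm 0 N f).
  { apply Rmult_le_pos; [apply pow_le; lra|].
    eapply Rle_trans; [|apply (seminorm_ub 0 N f 0 (proj1 Hf)); lra].
    simpl; rewrite Rmult_1_l; apply Cmod_ge_0. }
  eapply Rle_trans; [apply Rmult_le_compat_l; [lra|exact B]|].
  replace (Rpower t mu * (2 ^ N * t ^ N * seminorm 0 N f)) with
    ((Rpower t mu * t ^ N) * (2 ^ N * seminorm 0 N f)) by ring.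
  nra.
- intros t Ht; rewrite Cmod_mult, HP.
  eapply Rle_trans; [|apply (seminorm_ub K 0 f t (proj1 Hf)); lra].
  simpl half_line_derive_n; rewrite <- Rmult_assoc.
  apply Rmult_le_compat_r; [apply Cmod_ge_0|].
  rewrite <- !Rpower_pow, <- Rpower_plus by lra.
  apply Rpower_le_exponent; [exact Ht|]; simpl; lra.
Qed.

Lemma power_linear (beta mu : R) :
  linear_functional beta (fun phi => power_pairing mu phi).
Proof.
intros a b f g h E.
destruct (power_pairing_bound mu) as [N [K H]].
assert (If := proj1 (H f (proj1 (test_funP _ f)))).
assert (Ig := proj1 (H g (proj1 (test_funP _ g)))).
apply half_line_integral_unique.
assert (I := is_RInt_gen_plus _ _ _ _
  (is_half_line_integral_Cmult a _ _ If)
  (is_half_line_integral_Cmult b _ _ Ig)).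
revert I; apply is_half_line_integral_ext; intros t Ht.
rewrite (E t (Rlt_le _ _ Ht)); change plus with Cplus; ring.
Qed.

Lemma power_continuous (beta mu : R) :
  continuous_functional beta (fun phi => power_pairing mu phi).
Proof.
destruct (power_pairing_bound mu) as [N [K H]].
intros f eps He.
assert (H2 : 0 < 2 ^ N) by (apply pow_lt; lra).
exists (max N K), (eps / (2 ^ N + 1)); split.
{ apply Rdiv_lt_0_compat; lra. }
intros g Hg.
assert (Sf := proj1 (test_funP _ f)); assert (Sg := proj1 (test_funP _ g)).
destruct (H _ (S_plus_minus g f Sg Sf)) as [I B].
assert (I' := is_RInt_gen_minus _ _ _ _ (proj1 (H g Sg)) (proj1 (H f Sf))).
apply (is_half_line_integral_ext _
  (fun t => Cmult (RtoC (Rpower t mu)) (Cminus (g t) (f t)))) in I'.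
2: { intros t _; change minus with Cminus; ring. }
assert (E : power_pairing mu (fun x => Cminus (g x) (f x)) =
  Cminus (power_pairing mu g) (power_pairing mu f))
  by exact (half_line_integral_unique _ _ I').
change (Cmod (Cminus (power_pairing mu g) (power_pairing mu f)) < eps).
rewrite <- E.
assert (D1 : seminorm 0 N (fun x => Cminus (g x) (f x)) < eps / (2 ^ N + 1))
  by (apply Hg; lia).
assert (D2 : seminorm K 0 (fun x => Cminus (g x) (f x)) < eps / (2 ^ N + 1))
  by (apply Hg; lia).
apply Rle_lt_trans with (1 := B).
replace eps with (2 ^ N * (eps / (2 ^ N + 1)) + eps / (2 ^ N + 1))
  by (field; lra).
apply Rplus_lt_compat; [apply Rmult_lt_compat_l; assumption|assumption].
Qed.

Definition power_distribution (beta mu : R) : distribution beta :=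
  Distribution beta (fun phi => power_pairing mu phi)
    (power_linear beta mu) (power_continuous beta mu).

Definition solution_coef (alpha : R) (lambda c0 : C) (n : nat) : C :=
  (c0 * PI / Gamma (1 - alpha)
   * (lambda ^ n / sin (PI * (INR n + 1) * alpha))
   * / Gamma ((INR n + 1) * alpha))%C.

Definition solution_term (alpha : R) (lambda c0 : C) (t : R) (n : nat) : C :=
  (solution_coef alpha lambda c0 n * Rpower t (- (INR n * alpha)))%C.

Definition solution_term_dist (alpha : R) (lambda c0 : C) (n : nat)
    : distribution (1 - alpha) :=
  dist_scal (1 - alpha) (solution_coef alpha lambda c0 n)
    (power_distribution (1 - alpha) (- (INR n * alpha))).

(* Main.v *)
Require Import Defs.
From Stdlib Require Import Reals QArith Qreals Lra Lia.
From Coquelicot Require Import Coquelicot.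
Open Scope R_scope.

(** Pointwise, the coefficient [1 / Gamma ((n + 1) alpha)] decays faster than
    every geometric sequence ([Gamma_lower_bound]), while poor approximability
    keeps [|sin (PI (n + 1) alpha)|] above a multiple of a negative power of
    [n + 1], hence of a decaying exponential ([poorly_approximated_sin]).  So
    the series is dominated by a geometric one.

    Weak convergence would force the terms, paired with any fixed test
    function, to tend to zero.  The pairing with [t^(-n alpha)] can however
    grow much faster than [Gamma ((n + 1) alpha)]: a test function only has to
    be flat at the origin, which leaves room for moments that grow like the
    exponential of a square, as those of the log-normal density do.  The
    obstacle is that all moments of order [1 - alpha - k] have to vanish.
    Stieltjes's example of an indeterminate moment problem has both properties:
    for [phi x = x^(-beta) exp (- ln^2 x / 32) sin (PI ln x / 16)] the moment
    of order [mu] is a positive constant times [exp (8 s^2) sin (PI s)], where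
    [s = mu + 1 - beta] ([stieltjes_moment]).  With [beta = 1 - alpha] this
    vanishes for [mu = 1 - alpha - k], where [s] is an integer, whereas for
    [mu = - n alpha] it has absolute value of order
    [exp (8 (n - 1)^2 alpha^2) |sin (PI (n - 1) alpha)|].  The Gaussian
    factor beats the coefficient, as [Gamma x <= 1 + exp (x^2)] for [x >= 1]
    ([Gamma_large]), and the sine is bounded away from zero for one of any two
    consecutive [n] ([sin_consecutive]), so the terms do not tend to
    zero ([stieltjes_terms_large]). *)

(** * Integrals over the half-line *)

(** A convergent improper integral may be evaluated along one exhausting
    sequence of intervals; for the moments below, intervals that are symmetric
    about the centre of a Gaussian make the odd part cancel exactly. *)
Lemma is_RInt_gen_half_line_seq (V : CompleteNormedModule R_AbsRing)
    (f : R -> V) (l : V) (a b : nat -> R) (v : nat -> V) :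
  is_RInt_gen f (at_right 0) (Rbar_locally p_infty) l ->
  (forall n, 0 < a n) -> is_lim_seq a 0 -> is_lim_seq b p_infty ->
  (forall n, is_RInt f (a n) (b n) (v n)) ->
  filterlim v eventually (locally l).
Proof.
intros Hl Ha La Lb Hv P HP.
assert (Lab : filterlim (fun n => (a n, b n)) eventually
  (filter_prod (at_right 0) (Rbar_locally p_infty))).
{ apply filterlim_pair; [|exact Lb].
  intros Q HQ; specialize (La _ HQ); unfold filtermap in *; revert La.
  apply filter_imp; intros n Hn; exact (Hn (Ha n)). }
specialize (Lab _ (Hl P HP)); unfold filtermap in *; revert Lab.
apply filter_imp; intros n [y [Hy Py]]; simpl in Hy.
rewrite <- (is_RInt_unique _ _ _ _ (Hv n)).
now rewrite (is_RInt_unique _ _ _ _ Hy).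
Qed.

Lemma is_half_line_integral_seq_Cmod (f : R -> C) (l : C) (a b : nat -> R)
    (v : nat -> C) :
  is_half_line_integral f l ->
  (forall n, 0 < a n) -> is_lim_seq a 0 -> is_lim_seq b p_infty ->
  (forall n, is_RInt (V := C_R_NormedModule) f (a n) (b n) (v n)) ->
  is_lim_seq (fun n => Cmod (v n)) (Cmod l).
Proof.
intros Hl Ha La Lb Hv.
assert (L := is_RInt_gen_half_line_seq C_R_CompleteNormedModule f l a b v
  Hl Ha La Lb Hv).
assert (N := filterlim_comp _ _ _ _ _ _ _ _ L
  (filterlim_norm (V := C_R_NormedModule) l)).
rewrite <- (Defs.Cmod_norm l).
refine (is_lim_seq_ext _ _ (Finite _) _ N); intros n; apply Defs.Cmod_norm.
Qed.

Lemma is_RInt_RtoC (f : R -> R) (a b l : R) : is_RInt f a b l ->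
  is_RInt (V := C_R_NormedModule) (fun t => RtoC (f t)) a b (RtoC l).
Proof.
intros H; apply is_RInt_fct_extend_pair; simpl; [exact H|].
assert (Z := is_RInt_const (V := R_NormedModule) a b 0).
change (scal (b - a) 0) with ((b - a) * 0) in Z.
rewrite Rmult_0_r in Z; exact Z.
Qed.

Lemma is_half_line_integral_fst (f : R -> R) (l : C) :
  is_half_line_integral (fun t => RtoC (f t)) l ->
  is_RInt_gen f (at_right 0) (Rbar_locally p_infty) (fst l).
Proof.
intros H P HP.
assert (L := linear_cont (K := R_AbsRing) (U := C_R_NormedModule)
  (V := R_NormedModule) fst l
  (is_linear_fst (U := R_NormedModule) (V := R_NormedModule))).
specialize (H _ (L P HP)); revert H.
unfold filtermapi; apply filter_imp; intros ab [y [Hy Py]].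
exists (fst y); split; [|exact Py].
exact (is_RInt_fct_extend_fst (U := R_NormedModule) (V := R_NormedModule)
  _ _ _ _ Hy).
Qed.

Lemma RInt_ge_subinterval (f : R -> R) (a b c d m : R) :
  a <= c -> c <= d -> d <= b ->
  (forall x, a <= x <= b -> continuous f x) ->
  (forall x, a <= x <= b -> 0 <= f x) ->
  (forall x, c <= x <= d -> m <= f x) ->
  m * (d - c) <= RInt f a b.
Proof.
intros Hac Hcd Hdb Cf Pf Hm.
assert (Ex : forall u v, a <= u -> u <= v -> v <= b -> ex_RInt f u v).
{ intros u v Hu Huv Hv.
  apply (ex_RInt_continuous (V := R_CompleteNormedModule)).
  rewrite Rmin_left, Rmax_right by exact Huv; intros z Hz; apply Cf; lra. }
rewrite <- (RInt_Chasles f a c b), <- (RInt_Chasles f c d b)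
  by (apply Ex; lra).
assert (I1 : 0 <= RInt f a c).
{ apply RInt_ge_0; [lra|apply Ex; lra|]; intros; apply Pf; lra. }
assert (I3 : 0 <= RInt f d b).
{ apply RInt_ge_0; [lra|apply Ex; lra|]; intros; apply Pf; lra. }
assert (I2 : RInt (fun _ => m) c d <= RInt f c d).
{ apply RInt_le; [lra|apply ex_RInt_const|apply Ex; lra|].
  intros; apply Hm; lra. }
rewrite RInt_const in I2; unfold scal, plus in *; simpl in *.
unfold mult in I2; simpl in I2; lra.
Qed.

(** * Bounds for the Gamma function *)

Lemma Rpower_gt_0 (t x : R) : 0 < Rpower t x.
Proof. apply exp_pos. Qed.

Lemma exp_nondecr (x y : R) : x <= y -> exp x <= exp y.
Proof.
intros [H| ->]; [now apply Rlt_le, exp_increasing|apply Rle_refl].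
Qed.

Lemma continuous_Rpower_exp (x t : R) : 0 < t ->
  continuous (fun t => Rpower t x * exp (- t)) t.
Proof.
intros Ht; apply (ex_derive_continuous (fun t => Rpower t x * exp (- t))).
unfold Rpower; auto_derive; exact Ht.
Qed.

Lemma ln_le_sub_1 (x : R) : 0 < x -> ln x <= x - 1.
Proof.
intros Hx; assert (H := exp_ineq1_le (ln x)); rewrite exp_ln in H; lra.
Qed.

Lemma Rpower_le_1 (t x : R) : 0 < t <= 1 -> 0 <= x -> Rpower t x <= 1.
Proof.
intros Ht Hx; rewrite <- (Rpower_O t (proj1 Ht)); unfold Rpower.
apply exp_nondecr; assert (L := ln_le _ 1 (proj1 Ht) (proj2 Ht)).
rewrite ln_1 in L; nra.
Qed.

(** The maximum over [t] of [t^(x+1) e^(-t)] is [((x+1)/e)^(x+1)], and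
    [ln (x+1) <= x] turns this into a Gaussian bound. *)
Lemma Gamma_integrand_far (x t : R) : 1 <= x -> 1 <= t ->
  t ^ 2 * (Rpower t (x - 1) * exp (- t)) <= exp (x ^ 2).
Proof.
intros Hx Ht; rewrite <- Rmult_assoc, <- Rpower_pow, <- Rpower_plus by lra.
unfold Rpower; rewrite <- exp_plus; apply exp_nondecr.
assert (L1 := ln_le_sub_1 (t / (x + 1)) ltac:(apply Rdiv_lt_0_compat; lra)).
assert (L2 := ln_le_sub_1 (x + 1) ltac:(lra)).
rewrite ln_div in L1 by lra; simpl INR.
assert (M : (x + 1) * ln t <= (x + 1) * (t / (x + 1) - 1 + x)).
{ apply Rmult_le_compat_l; lra. }
replace ((x + 1) * (t / (x + 1) - 1 + x)) with (t + (x + 1) * (x - 1)) in M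
  by (field; lra).
replace (1 + 1 + (x - 1)) with (x + 1) by ring.
nra.
Qed.

Lemma Gamma_large (x : R) : 1 <= x ->
  is_RInt_gen (fun t => Rpower t (x - 1) * exp (- t))
    (at_right 0) (Rbar_locally p_infty) (Gamma x) /\
  Gamma x <= 1 + exp (x ^ 2).
Proof.
intros Hx.
assert (Hpos : forall t, Cmod (RtoC (Rpower t (x - 1) * exp (- t))) =
  Rpower t (x - 1) * exp (- t)).
{ intros t; rewrite Cmod_R; apply Rabs_pos_eq.
  apply Rmult_le_pos; apply Rlt_le, exp_pos. }
destruct (half_line_integral_dominated
  (fun t => RtoC (Rpower t (x - 1) * exp (- t))) 1 (exp (x ^ 2)))
  as [I B].
- intros t Ht.
  apply (continuous_ext
    (fun t => scal (Rpower t (x - 1) * exp (- t)) (RtoC 1 : C_R_NormedModule))).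
  { intros u; rewrite scal_R_Cmult; apply Cmult_1_r. }
  apply (continuous_scal_l (V := C_R_NormedModule)).
  now apply continuous_Rpower_exp.
- intros t Ht; rewrite Hpos.
  assert (P1 := Rpower_le_1 t (x - 1) Ht ltac:(lra)).
  assert (P2 : exp (- t) <= 1) by (rewrite <- exp_0; apply exp_nondecr; lra).
  assert (P3 := Rpower_gt_0 t (x - 1)); assert (P4 := exp_pos (- t)); nra.
- intros t Ht; rewrite Hpos; now apply Gamma_integrand_far.
- apply is_half_line_integral_fst in I.
  assert (E : Gamma x = fst (half_line_integral
    (fun t => RtoC (Rpower t (x - 1) * exp (- t))))).
  { exact (is_RInt_gen_unique _ _ I). }
  rewrite E; split; [exact I|].
  eapply Rle_trans; [apply Rle_abs|].
  eapply Rle_trans; [|exact B].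
  eapply Rle_trans; [apply Rmax_l|apply Rmax_Cmod].
Qed.

(** For [M <= t <= 2 M] the integrand is at least [M^(x-1) e^(-2M)]; as [M] is
    free, this shows that [Gamma] grows faster than every exponential. *)
Lemma Gamma_lower_bound (M x : R) : 0 < M -> 1 <= x ->
  Rpower M x * exp (- (2 * M)) <= Gamma x.
Proof.
intros HM Hx; destruct (Gamma_large x Hx) as [I _].
assert (Ha : forall n, 0 < M / (INR n + 1)).
{ intros n; assert (P := pos_INR n); apply Rdiv_lt_0_compat; lra. }
assert (Ex : forall n, is_RInt (fun t => Rpower t (x - 1) * exp (- t))
  (M / (INR n + 1)) (2 * M + INR n)
  (RInt (fun t => Rpower t (x - 1) * exp (- t))
    (M / (INR n + 1)) (2 * M + INR n))).
{ intros n; assert (P := pos_INR n).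
  apply (RInt_correct (V := R_CompleteNormedModule)).
  apply (ex_RInt_continuous (V := R_CompleteNormedModule)); intros z Hz.
  apply continuous_Rpower_exp; specialize (Ha n).
  assert (0 < Rmin (M / (INR n + 1)) (2 * M + INR n))
    by (apply Rmin_pos; lra).
  lra. }
assert (L : is_lim_seq (fun n => RInt (fun t => Rpower t (x - 1) * exp (- t))
  (M / (INR n + 1)) (2 * M + INR n)) (Gamma x)).
{ refine (is_RInt_gen_half_line_seq R_CompleteNormedModule _ _ _ _ _
    I Ha _ _ Ex).
  - apply is_lim_seq_ext with (fun n => M * / INR (S n)).
    { intros n; now rewrite S_INR. }
    replace (Finite 0) with (Rbar_mult M 0) by (simpl; f_equal; ring).
    apply is_lim_seq_scal_l.
    apply (is_lim_seq_incr_1 (fun n => / INR n)).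
    replace (Finite 0) with (Rbar_inv p_infty) by reflexivity.
    apply is_lim_seq_inv; [apply is_lim_seq_INR|easy].
  - apply is_lim_seq_plus with (2 * M) p_infty;
      [apply is_lim_seq_const|apply is_lim_seq_INR|reflexivity]. }
refine (is_lim_seq_le _ _ (Finite _) (Finite _) _ (is_lim_seq_const _) L).
intros n; specialize (Ha n); assert (P := pos_INR n).
replace (Rpower M x * exp (- (2 * M))) with
  (Rpower M (x - 1) * exp (- (2 * M)) * (2 * M - M)).
2: { replace x with (x - 1 + 1) at 2 by ring.
  rewrite Rpower_plus, Rpower_1 by exact HM; ring. }
assert (Hd : M / (INR n + 1) <= M).
{ apply Rmult_le_reg_r with (INR n + 1); [lra|].
  unfold Rdiv; rewrite Rmult_assoc, Rinv_l by lra; nra. }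
apply RInt_ge_subinterval; try lra.
- intros t Ht; apply continuous_Rpower_exp; lra.
- intros t Ht; apply Rmult_le_pos; apply Rlt_le, exp_pos.
- intros t Ht; apply Rmult_le_compat; try (apply Rlt_le, exp_pos).
  + apply Rle_Rpower_l; lra.
  + apply exp_nondecr; lra.
Qed.

(** Below [1] the integrand is unbounded near [0]; integration by parts,
    [Gamma x = Gamma (x + 1) / x], reduces to an exponent at least [1]. *)
Lemma Gamma_pos (x : R) : 0 < x -> 0 < Gamma x.
Proof.
intros Hx; destruct (Gamma_large (x + 1)) as [I _]; [lra|].
assert (G : 0 < Gamma (x + 1)).
{ eapply Rlt_le_trans; [|apply (Gamma_lower_bound 1); lra].
  apply Rmult_lt_0_compat; apply exp_pos. }
set (F := fun t => / x * (Rpower t x * exp (- t))).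
set (dF := fun t => Rpower t (x - 1) * exp (- t) -
  / x * (Rpower t (x + 1 - 1) * exp (- t))).
assert (Pt : forall t, 0 < t -> Rpower t x = t * Rpower t (x - 1)).
{ intros t Ht; rewrite <- (Rpower_1 t Ht) at 2; rewrite <- Rpower_plus.
  f_equal; ring. }
assert (DF : forall t, 0 < t -> is_derive F t (dF t)).
{ intros t Ht; unfold F, dF; replace (x + 1 - 1) with x by ring.
  rewrite (Pt t Ht); unfold Rpower; auto_derive; [exact Ht|].
  change (exp (x * ln t)) with (Rpower t x); rewrite (Pt t Ht).
  unfold Rpower; field; lra. }
assert (CF : forall t, 0 < t -> continuous dF t).
{ intros t Ht; apply (ex_derive_continuous dF); unfold dF, Rpower.
  auto_derive; tauto. }
assert (J : is_RInt_gen dF (at_right 0) (Rbar_locally p_infty) (minus 0 0)).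
{ intros P HP.
  assert (L0 : filterlim F (at_right 0) (locally 0)).
  { apply (filterlim_locally F 0); intros eps; assert (He := cond_pos eps).
    exists (mkposreal _ (Rpower_gt_0 (x * eps) (/ x))); intros t Bt Ht.
    assert (R : Rabs (t - 0) < Rpower (x * eps) (/ x)) by exact Bt.
    rewrite Rminus_0_r, Rabs_pos_eq in R by lra.
    assert (R' := Rlt_Rpower_l t _ x Hx (conj Ht R)); clear R.
    rewrite Rpower_mult, Rinv_l, Rpower_1 in R' by nra.
    change (Rabs (F t - 0) < eps); rewrite Rminus_0_r.
    assert (P0 := Rpower_gt_0 t x); assert (P1 := exp_pos (- t)).
    assert (P2 : exp (- t) <= 1) by (rewrite <- exp_0; apply exp_nondecr; lra).
    assert (Hi : 0 < / x) by now apply Rinv_0_lt_compat.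
    unfold F; rewrite Rabs_pos_eq by (apply Rmult_le_pos; nra).
    apply Rmult_lt_reg_l with x; [exact Hx|].
    rewrite <- Rmult_assoc, Rinv_r, Rmult_1_l by lra; nra. }
  assert (Loo : filterlim F (Rbar_locally p_infty) (locally 0)).
  { apply (filterlim_locally F 0); intros eps; assert (He := cond_pos eps).
    set (K := / x * exp ((x + 1) ^ 2)).
    assert (HK : 0 < K) by (apply Rmult_lt_0_compat;
      [now apply Rinv_0_lt_compat|apply exp_pos]).
    exists (Rmax 1 (K / eps)); intros t Ht.
    assert (T1 := Rmax_l 1 (K / eps)); assert (T2 := Rmax_r 1 (K / eps)).
    assert (B := Gamma_integrand_far (x + 1) t ltac:(lra) ltac:(lra)).
    replace (x + 1 - 1) with x in B by ring.
    assert (P0 : 0 < Rpower t x * exp (- t))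
      by (apply Rmult_lt_0_compat; apply exp_pos).
    assert (Hi : 0 < / x) by now apply Rinv_0_lt_compat.
    change (Rabs (F t - 0) < eps); rewrite Rminus_0_r.
    unfold F; rewrite Rabs_pos_eq by nra.
    apply Rmult_lt_reg_l with t; [lra|].
    apply Rle_lt_trans with K.
    - unfold K; rewrite <- Rmult_assoc, (Rmult_comm t), Rmult_assoc.
      apply Rmult_le_compat_l; [lra|]; eapply Rle_trans; [|exact B].
      apply Rmult_le_compat_r; [lra|nra].
    - apply Rmult_lt_reg_r with (/ eps); [now apply Rinv_0_lt_compat|].
      rewrite Rmult_assoc, Rinv_r by lra; unfold Rdiv in *; lra. }
  assert (L : filterlim (fun ab => minus (F (snd ab)) (F (fst ab)))
    (filter_prod (at_right 0) (Rbar_locally p_infty)) (locally (minus 0 0))).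
  { apply (filterlim_comp_2 (G := locally 0) (H := locally (opp 0))
      (fun ab => F (snd ab)) (fun ab => opp (F (fst ab))) plus).
    - apply filterlim_comp with (2 := Loo), filterlim_snd.
    - apply (filterlim_comp _ _ _ (fun ab => F (fst ab)) opp _ (locally 0)).
      + apply filterlim_comp with (2 := L0), filterlim_fst.
      + apply (filterlim_opp (V := R_NormedModule)).
    - apply (filterlim_plus (V := R_NormedModule)). }
  specialize (L P HP).
  assert (Q : filter_prod (at_right 0) (Rbar_locally p_infty)
    (fun ab : R * R => 0 < fst ab /\ 0 < snd ab)).
  { apply Filter_prod with (fun a => 0 < a) (fun b => 0 < b).
    - exists (mkposreal 1 Rlt_0_1); intros y _ Hy; exact Hy.
    - exists 0; easy.
    - easy. }
  unfold filtermap in L; unfold filtermapi.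
  generalize (filter_and _ _ L Q); apply filter_imp.
  intros [a b] [H [Ha Hb]]; simpl in *; eexists; split; [|exact H].
  assert (Hm := Rmin_pos a b Ha Hb).
  apply (is_RInt_derive (V := R_CompleteNormedModule) F dF);
    intros z Hz; [apply DF|apply CF]; lra. }
assert (S := is_RInt_gen_plus _ _ _ _ J (is_RInt_gen_scal _ (/ x) _ I)).
assert (E : Gamma x = plus (minus 0 0) (scal (/ x) (Gamma (x + 1)))).
{ refine (is_RInt_gen_unique _ _ (is_RInt_gen_ext _ _ _ _ S)).
  apply filter_forall; intros ab t _.
  unfold dF, plus, scal; simpl; unfold mult; simpl; ring. }
rewrite E; unfold minus, plus, opp, scal; simpl; unfold mult; simpl.
assert (Hi : 0 < / x) by now apply Rinv_0_lt_compat.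
nra.
Qed.

(** * A log-normal family of flat Schwartz functions *)

(** An algebra of functions of [y = ln x] that is closed under [d/dy] and
    multiplication by powers of [x], and whose members a Gaussian dominates. *)
Inductive tame : (R -> R) -> Prop :=
| tame_const (c : R) : tame (fun _ => c)
| tame_id : tame (fun y => y)
| tame_exp (a : R) : tame (fun y => exp (a * y))
| tame_sin (w : R) : tame (fun y => sin (w * y))
| tame_cos (w : R) : tame (fun y => cos (w * y))
| tame_plus (E F : R -> R) : tame E -> tame F -> tame (fun y => E y + F y)
| tame_mult (E F : R -> R) : tame E -> tame F -> tame (fun y => E y * F y).

Lemma tame_derive (E : R -> R) : tame E ->
  exists E', tame E' /\ forall y, is_derive E y (E' y).
Proof.
induction 1 as [c| |a|w|w|E F HE [E' [TE DE]] HF [F' [TF DF]]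
  |E F HE [E' [TE DE]] HF [F' [TF DF]]].
- exists (fun _ => 0); split; [constructor|].
  intros y; auto_derive; [easy|ring].
- exists (fun _ => 1); split; [constructor|].
  intros y; auto_derive; [easy|ring].
- exists (fun y => a * exp (a * y)); split; [repeat constructor|].
  intros y; auto_derive; [easy|ring].
- exists (fun y => w * cos (w * y)); split; [repeat constructor|].
  intros y; auto_derive; [easy|ring].
- exists (fun y => - w * sin (w * y)); split; [repeat constructor|].
  intros y; auto_derive; [easy|ring].
- exists (fun y => E' y + F' y); split; [now constructor|].
  intros y; exact (is_derive_plus E F y _ _ (DE y) (DF y)).
- exists (fun y => E' y * F y + E y * F' y); split; [now repeat constructor|].
  intros y; exact (is_derive_mult E F y _ _ (DE y) (DF y) Rmult_comm).
Qed.

Lemma tame_exp_bound (E : R -> R) : tame E ->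
  exists A a, 0 <= a /\ forall y, Rabs (E y) <= A * exp (a * Rabs y).
Proof.
assert (One : forall y, 1 * exp (0 * Rabs y) = 1).
{ intros y; now rewrite Rmult_0_l, exp_0, Rmult_1_l. }
assert (Nonneg : forall (E : R -> R) A a,
  (forall y, Rabs (E y) <= A * exp (a * Rabs y)) -> 0 <= A).
{ intros E0 A a H; specialize (H 0).
  rewrite Rabs_R0, Rmult_0_r, exp_0, Rmult_1_r in H.
  eapply Rle_trans; [apply Rabs_pos|exact H]. }
induction 1 as [c| |a|w|w|E F HE [A [a [Ha BE]]] HF [B [b [Hb BF]]]
  |E F HE [A [a [Ha BE]]] HF [B [b [Hb BF]]]].
- exists (Rabs c), 0; split; [lra|]; intros y.
  rewrite Rmult_0_l, exp_0; lra.
- exists 1, 1; split; [lra|]; intros y.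
  assert (H := exp_ineq1_le (1 * Rabs y)); lra.
- exists 1, (Rabs a); split; [apply Rabs_pos|]; intros y.
  rewrite Rmult_1_l, Rabs_pos_eq, <- Rabs_mult by apply Rlt_le, exp_pos.
  apply exp_nondecr, Rle_abs.
- exists 1, 0; split; [lra|]; intros y; rewrite One.
  apply Rabs_le, SIN_bound.
- exists 1, 0; split; [lra|]; intros y; rewrite One.
  apply Rabs_le, COS_bound.
- exists (A + B), (a + b); split; [lra|]; intros y.
  assert (NA := Nonneg E A a BE); assert (NB := Nonneg F B b BF).
  specialize (BE y); specialize (BF y); assert (Hy := Rabs_pos y).
  assert (Ea : exp (a * Rabs y) <= exp ((a + b) * Rabs y))
    by (apply exp_nondecr; nra).
  assert (Eb : exp (b * Rabs y) <= exp ((a + b) * Rabs y))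
    by (apply exp_nondecr; nra).
  eapply Rle_trans; [apply Rabs_triang|]; nra.
- exists (A * B), (a + b); split; [lra|]; intros y.
  rewrite Rabs_mult, Rmult_plus_distr_r, exp_plus.
  replace (A * B * (exp (a * Rabs y) * exp (b * Rabs y)))
    with ((A * exp (a * Rabs y)) * (B * exp (b * Rabs y))) by ring.
  apply Rmult_le_compat; (apply Rabs_pos || auto).
Qed.

Lemma tame_gaussian_bound (E : R -> R) : tame E ->
  exists M, 0 <= M /\ forall y, Rabs (E y) * exp (- y ^ 2 / 32) <= M.
Proof.
intros HE; destruct (tame_exp_bound E HE) as [A [a [Ha B]]].
assert (HA : 0 <= A).
{ specialize (B 0); rewrite Rabs_R0, Rmult_0_r, exp_0, Rmult_1_r in B.
  eapply Rle_trans; [apply Rabs_pos|exact B]. }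
exists (A * exp (8 * a ^ 2)); split.
{ apply Rmult_le_pos; [exact HA|apply Rlt_le, exp_pos]. }
intros y; specialize (B y).
apply Rle_trans with (A * exp (a * Rabs y) * exp (- y ^ 2 / 32)).
{ apply Rmult_le_compat_r; [apply Rlt_le, exp_pos|exact B]. }
rewrite Rmult_assoc, <- exp_plus.
apply Rmult_le_compat_l; [exact HA|]; apply exp_nondecr.
rewrite <- (pow2_abs y); assert (S := pow2_ge_0 (Rabs y - 16 * a)); nra.
Qed.

Definition log_gaussian (E : R -> R) (x : R) : C :=
  if Rlt_dec 0 x then RtoC (E (ln x) * exp (- ln x ^ 2 / 32)) else RtoC 0.

Lemma log_gaussian_pos (E : R -> R) (x : R) : 0 < x ->
  log_gaussian E x = RtoC (E (ln x) * exp (- ln x ^ 2 / 32)).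
Proof. intros Hx; unfold log_gaussian; destruct (Rlt_dec 0 x); tauto. Qed.

Lemma log_gaussian_0 (E : R -> R) : log_gaussian E 0 = RtoC 0.
Proof.
unfold log_gaussian; destruct (Rlt_dec 0 0); [|easy].
now apply Rlt_irrefl in r.
Qed.

(** Flatness at [0] and rapid decay at infinity at once. *)
Lemma log_gaussian_Rpower_bound (E : R -> R) (a : R) : tame E ->
  exists M, 0 <= M /\
    forall x, 0 < x -> Rpower x a * Cmod (log_gaussian E x) <= M.
Proof.
intros HE.
destruct (tame_gaussian_bound _ (tame_mult _ _ (tame_exp a) HE)) as [M [H0 H]].
exists M; split; [exact H0|]; intros x Hx; specialize (H (ln x)).
rewrite log_gaussian_pos, Cmod_R, Rabs_mult by exact Hx.
rewrite Rabs_mult in H; unfold Rpower.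
rewrite (Rabs_pos_eq (exp (a * _))) in H by apply Rlt_le, exp_pos.
rewrite (Rabs_pos_eq (exp (- _ / _))) by apply Rlt_le, exp_pos; lra.
Qed.

Lemma is_derive_RtoC (g : R -> R) (x l : R) : is_derive g x l ->
  is_derive (V := C_R_NormedModule) (fun y => RtoC (g y)) x (RtoC l).
Proof.
intros H.
assert (D := is_derive_scal_l (V := C_R_NormedModule) g x l (RtoC 1) H).
rewrite scal_R_Cmult, Cmult_1_r in D; revert D.
apply is_derive_ext; intros y; rewrite scal_R_Cmult; apply Cmult_1_r.
Qed.

Lemma log_gaussian_derive (E : R -> R) : tame E ->
  exists E', tame E' /\ forall x, 0 <= x ->
    is_half_line_derive (log_gaussian E) x (log_gaussian E' x).
Proof.
intros HE; destruct (tame_derive E HE) as [D [TD HD]].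
exists (fun y => exp (-1 * y) * (D y + - / 16 * y * E y)).
split; [now repeat constructor|]; intros x Hx.
assert (FF := within_half_line_proper x Hx).
destruct Hx as [Hx|Hx].
- apply (filterdiff_locally _ x); [apply within_half_line_lim|].
  change (is_derive (V := C_R_NormedModule) (log_gaussian E) x
    (log_gaussian (fun y => exp (-1 * y) * (D y + - / 16 * y * E y)) x)).
  rewrite log_gaussian_pos by exact Hx.
  apply (is_derive_ext_loc
    (fun x => RtoC (E (ln x) * exp (- ln x ^ 2 / 32)))).
  { exists (mkposreal x Hx); intros y By; symmetry; apply log_gaussian_pos.
    assert (B : Rabs (y - x) < x) by exact By.
    apply Rabs_def2 in B; lra. }
  apply is_derive_RtoC.
  replace (-1 * ln x) with (- ln x) by ring; rewrite exp_Ropp, exp_ln by easy.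
  assert (X : is_derive (fun x => E (ln x)) x (scal (/ x) (D (ln x)))).
  { apply (is_derive_comp E ln); [apply HD|].
    now apply is_derive_Reals, derivable_pt_lim_ln. }
  assert (Y : is_derive (fun x => exp (- ln x ^ 2 / 32)) x
    (- / 16 * ln x * / x * exp (- ln x ^ 2 / 32))).
  { auto_derive; [exact Hx|]; unfold Rdiv; simpl pow; field; lra. }
  assert (Z := is_derive_mult _ _ x _ _ X Y Rmult_comm).
  revert Z; unfold scal, plus, mult; simpl; unfold mult; simpl.
  match goal with |- is_derive _ _ ?u -> is_derive _ _ ?v =>
    replace v with u by (field; lra); easy end.
(* At the endpoint the difference quotient is controlled by the bound
   [|f x| <= M x^2]. *)
- subst x; rewrite log_gaussian_0.
  destruct (log_gaussian_Rpower_bound E (-2) HE) as [M [HM BM]].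
  split.
  { apply (is_linear_scal_l (V := C_R_NormedModule)). }
  intros x Lx eps.
  rewrite (is_filter_lim_unique (V := R_NormedModule) _ _ Lx
             (within_half_line_lim 0)).
  assert (He : 0 < eps / (M + 1))
    by (apply Rdiv_lt_0_compat; [apply cond_pos|lra]).
  exists (mkposreal _ He); intros y By Hy.
  assert (R : Rabs (y - 0) < eps / (M + 1)) by exact By.
  rewrite Rminus_0_r, Rabs_pos_eq in R by exact Hy.
  apply (Rmult_lt_compat_r (M + 1)) in R; [|lra].
  unfold Rdiv in R; rewrite Rmult_assoc, Rinv_l, Rmult_1_r in R by lra.
  replace (minus (minus _ _) _) with (log_gaussian E y : C_R_NormedModule).
  2: { rewrite log_gaussian_0.
    change (@eq C (log_gaussian E y) (Cminus (Cminus (log_gaussian E y)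
      (RtoC 0)) (scal (minus y 0) (RtoC 0 : C_R_NormedModule)))).
    rewrite scal_R_Cmult; ring. }
  rewrite Defs.Cmod_norm.
  change (Cmod (log_gaussian E y) <= eps * Rabs (y - 0)).
  rewrite Rminus_0_r, Rabs_pos_eq by exact Hy.
  destruct Hy as [Hy|Hy]; [|subst y; rewrite log_gaussian_0, Cmod_0; lra].
  specialize (BM y Hy).
  assert (Q : Rpower y (-2) = / y ^ 2).
  { replace (-2) with (- INR 2) by (simpl; ring).
    now rewrite Rpower_Ropp, Rpower_pow. }
  rewrite Q in BM; apply (Rmult_le_compat_l (y ^ 2)) in BM; [|nra].
  rewrite <- Rmult_assoc, Rinv_r, Rmult_1_l in BM by nra; nra.
Qed.

Lemma log_gaussian_derive_n (E : R -> R) (l : nat) : tame E ->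
  exists E', tame E' /\ forall x, 0 <= x ->
    half_line_derive_n l (log_gaussian E) x = log_gaussian E' x.
Proof.
intros HE; induction l as [|l [E1 [T1 H1]]]; [now exists E|].
destruct (log_gaussian_derive E1 T1) as [E2 [T2 H2]].
exists E2; split; [exact T2|]; intros x Hx.
apply half_line_derive_eq; [exact Hx|].
refine (is_half_line_derive_ext _ _ x _ Hx _ (H2 x Hx)).
intros y Hy; symmetry; exact (H1 y Hy).
Qed.

Lemma log_gaussian_S_plus (E : R -> R) : tame E -> S_plus (log_gaussian E).
Proof.
intros HE; split; [split|].
- intros l x Hx; destruct (log_gaussian_derive_n E l HE) as [E1 [T1 H1]].
  destruct (log_gaussian_derive E1 T1) as [E2 [T2 H2]]; eexists.
  refine (is_half_line_derive_ext _ _ x _ Hx _ (H2 x Hx)).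
  intros y Hy; symmetry; exact (H1 y Hy).
- intros k l; destruct (log_gaussian_derive_n E l HE) as [E1 [T1 H1]].
  destruct (log_gaussian_Rpower_bound E1 (INR k) T1) as [M [HM BM]].
  exists M; intros x Hx; rewrite (H1 x Hx); destruct Hx as [Hx| <-].
  + rewrite <- Rpower_pow by exact Hx; now apply BM.
  + rewrite log_gaussian_0, Cmod_0; lra.
- intros l; destruct (log_gaussian_derive_n E l HE) as [E1 [T1 H1]].
  rewrite (H1 0 (Rle_refl 0)); apply log_gaussian_0.
Qed.

(** * The Stieltjes test function *)

(** The classical example of an indeterminate moment problem: the substitution
    [t = exp (16 s + z)] turns its moments into Gaussian integrals of
    [sin (PI s + PI z / 16)], whose odd part drops out.  The frequency [PI / 16]
    is the one for which the shift [16 s], forced by the width of the Gaussian,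
    becomes the phase [PI s]; the width is large enough for the remaining
    cosine integral to be positive by an elementary estimate. *)
Definition stieltjes_fun (beta : R) : R -> C :=
  log_gaussian (fun y => exp (- beta * y) * sin (PI / 16 * y)).

Lemma stieltjes_S_plus (beta : R) : S_plus (stieltjes_fun beta).
Proof. apply log_gaussian_S_plus; repeat constructor. Qed.

Definition gauss_cos (z : R) : R := exp (- z ^ 2 / 32) * cos (PI / 16 * z).
Definition gauss_sin (z : R) : R := exp (- z ^ 2 / 32) * sin (PI / 16 * z).

Lemma continuous_gauss_cos (z : R) : continuous gauss_cos z.
Proof.
apply (ex_derive_continuous gauss_cos); unfold gauss_cos; auto_derive; easy.
Qed.

Lemma continuous_gauss_sin (z : R) : continuous gauss_sin z.
Proof.
apply (ex_derive_continuous gauss_sin); unfold gauss_sin; auto_derive; easy.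
Qed.

Lemma RInt_gauss_sin (N : R) : RInt gauss_sin (- N) N = 0.
Proof.
assert (I := RInt_correct (V := R_CompleteNormedModule) gauss_sin N (- N)
  (ex_RInt_continuous (V := R_CompleteNormedModule) _ _ _
    (fun z _ => continuous_gauss_sin z))).
set (v := RInt gauss_sin N (- N)) in I.
assert (I1 := is_RInt_swap _ _ _ _ I).
rewrite <- (Ropp_involutive N) in I at 1.
apply (is_RInt_comp_opp (V := R_NormedModule)) in I.
apply (is_RInt_ext _ gauss_sin) in I.
- assert (E1 := is_RInt_unique _ _ _ _ I1).
  assert (E2 := is_RInt_unique _ _ _ _ I).
  rewrite E1 in E2; unfold opp in *; simpl in *; lra.
- intros z _; unfold gauss_sin, opp; simpl.
  replace (PI / 16 * - z) with (- (PI / 16 * z)) by ring; rewrite sin_neg.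
  replace (- (- z * (- z * 1)) / 32) with (- (z * (z * 1)) / 32) by field.
  ring.
Qed.

Lemma stieltjes_RInt (beta mu N : R) :
  let s := mu + 1 - beta in
  is_RInt (V := C_R_NormedModule)
    (fun t => Cmult (RtoC (Rpower t mu)) (stieltjes_fun beta t))
    (exp (16 * s - N)) (exp (16 * s + N))
    (RtoC (exp (8 * s ^ 2) * sin (PI * s) * RInt gauss_cos (- N) N)).
Proof.
intros s.
set (f := fun t => Rpower t mu * (exp (- beta * ln t) * sin (PI / 16 * ln t) *
  exp (- ln t ^ 2 / 32))).
apply (is_RInt_ext (fun t => RtoC (f t))).
{ intros t Ht; assert (H := Rmin_pos _ _ (exp_pos (16 * s - N))
    (exp_pos (16 * s + N))).
  unfold f, stieltjes_fun; rewrite log_gaussian_pos by lra.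
  now rewrite RtoC_mult. }
apply is_RInt_RtoC.
assert (Cf : forall t, 0 < t -> continuous f t).
{ intros t Ht; apply (ex_derive_continuous f); unfold f, Rpower.
  auto_derive; tauto. }
assert (If : ex_RInt f (exp (16 * s - N)) (exp (16 * s + N))).
{ apply (ex_RInt_continuous (V := R_CompleteNormedModule)); intros t Ht.
  assert (H := Rmin_pos _ _ (exp_pos (16 * s - N)) (exp_pos (16 * s + N))).
  apply Cf; lra. }
assert (I : is_RInt (fun z => scal (exp (16 * s + z)) (f (exp (16 * s + z))))
  (- N) N (RInt f (exp (16 * s + - N)) (exp (16 * s + N)))).
{ apply (is_RInt_comp (V := R_CompleteNormedModule) f
    (fun z => exp (16 * s + z)) (fun z => exp (16 * s + z))).
  - intros z _; apply Cf, exp_pos.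
  - intros z _; split.
    + auto_derive; [easy|ring].
    + apply (ex_derive_continuous (fun z => exp (16 * s + z))).
      auto_derive; easy. }
assert (X : forall g : R -> R, (forall z, continuous g z) ->
  is_RInt g (- N) N (RInt g (- N) N)).
{ intros g Cg; apply (RInt_correct (V := R_CompleteNormedModule)).
  apply (ex_RInt_continuous (V := R_CompleteNormedModule)); auto. }
assert (J := is_RInt_plus _ _ _ _ _ _
  (is_RInt_scal _ _ _ (exp (8 * s ^ 2) * sin (PI * s)) _
    (X _ continuous_gauss_cos))
  (is_RInt_scal _ _ _ (exp (8 * s ^ 2) * cos (PI * s)) _
    (X _ continuous_gauss_sin))).
rewrite RInt_gauss_sin in J.
apply (is_RInt_ext _ (fun z => scal (exp (16 * s + z))
  (f (exp (16 * s + z))))) in J.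
- replace (_ * RInt gauss_cos _ _)
    with (RInt f (exp (16 * s - N)) (exp (16 * s + N))).
  { now apply (RInt_correct (V := R_CompleteNormedModule)). }
  change (16 * s - N) with (16 * s + - N).
  rewrite <- (is_RInt_unique _ _ _ _ I).
  rewrite (is_RInt_unique _ _ _ _ J).
  unfold plus, scal; simpl; unfold mult; simpl; ring.
- intros z _; unfold plus, scal, f, Rpower; simpl; unfold mult; simpl.
  rewrite ln_exp; unfold gauss_cos, gauss_sin; simpl.
  replace (PI / 16 * (16 * s + z)) with (PI * s + PI / 16 * z) by field.
  rewrite sin_plus.
  (* Completing the square in the exponent: [16 s] is the point at which
     [s y - y^2 / 32] is maximal. *)
  assert (E : exp (8 * s ^ 2) * exp (- z ^ 2 / 32) =
    exp (16 * s + z) * (exp (mu * (16 * s + z)) * (exp (- beta * (16 * s + z))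
      * exp (- (16 * s + z) ^ 2 / 32)))).
  { rewrite <- !exp_plus; f_equal; unfold s; field. }
  simpl in E; set (S := sin _ * _ + _).
  transitivity (exp (8 * (s * (s * 1))) * exp (- (z * (z * 1)) / 32) * S);
    [unfold S; ring|rewrite E; ring].
Qed.

Lemma pow2_sin_le (x : R) : sin x ^ 2 <= x ^ 2.
Proof.
assert (P : forall y, 0 < y -> Rabs (sin y) <= Rabs y).
{ intros y Hy; rewrite (Rabs_pos_eq y) by lra; apply Rabs_le.
  assert (B := SIN_bound y); assert (U := sin_lt_x y Hy).
  split; [|lra]; destruct (Rle_dec 1 y); [lra|].
  assert (0 <= sin y); [|lra].
  apply sin_ge_0; [lra|]; assert (Q := PI2_3_2); lra. }
rewrite <- (pow2_abs (sin x)), <- (pow2_abs x).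
apply pow_incr; split; [apply Rabs_pos|].
destruct (Rtotal_order x 0) as [H|[->|H]].
- rewrite <- (Rabs_Ropp x), <- (Rabs_Ropp (sin x)), <- sin_neg; apply P; lra.
- rewrite sin_0; apply Rle_refl.
- now apply P.
Qed.

Lemma cos_ge_parabola (x : R) : 1 - x ^ 2 / 2 <= cos x.
Proof.
replace x with (2 * (x / 2)) at 2 by field; rewrite cos_2a_sin.
assert (H := pow2_sin_le (x / 2)); nra.
Qed.

(** The parabola [1 - u^2/2 <= cos u] reduces the Gaussian integral of the
    cosine to that of [1 - PI^2 z^2/512], and [(1 - z^2/16) exp (-z^2/32)] is
    the derivative of [z exp (-z^2/32)]; what is left over is
    [(1 - PI^2/32) exp (-z^2/32)]. *)
Lemma RInt_gauss_cos_lower_bound (N : R) : 1 <= N ->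
  exp (- 1 / 32) <= RInt gauss_cos (- N) N.
Proof.
intros HN.
set (g := fun z => exp (- z ^ 2 / 32)).
set (h := fun z => (1 - z ^ 2 / 16) * exp (- z ^ 2 / 32)).
set (p := PI ^ 2 / 32).
assert (Hp : 0 <= p <= 1 / 2).
{ unfold p; assert (P4 := PI_4); assert (P0 := PI_RGT_0); nra. }
assert (Cg : forall z, continuous g z).
{ intros z; apply (ex_derive_continuous g); unfold g; auto_derive; easy. }
assert (Ch : forall z, continuous h z).
{ intros z; apply (ex_derive_continuous h); unfold h; auto_derive; easy. }
assert (Ex : forall k : R -> R, (forall z, continuous k z) ->
  ex_RInt k (- N) N).
{ intros k Ck; apply (ex_RInt_continuous (V := R_CompleteNormedModule)); auto. }
assert (Ih : is_RInt h (- N) N (2 * N * exp (- N ^ 2 / 32))).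
{ replace (2 * N * exp (- N ^ 2 / 32)) with
    (minus (N * exp (- N ^ 2 / 32)) (- N * exp (- (- N) ^ 2 / 32))).
  2: { unfold minus, plus, opp; simpl.
    replace (- N * (- N * 1)) with (N * (N * 1)) by ring; ring. }
  apply (is_RInt_derive (V := R_CompleteNormedModule)
    (fun z => z * exp (- z ^ 2 / 32))); intros z _; [|apply Ch].
  unfold h; auto_derive; [easy|unfold Rdiv; simpl pow; field]. }
assert (Ig : 1 / 2 * exp (- 1 / 32) * (1 - -1) <=
  RInt (fun z => (1 - p) * g z) (- N) N).
{ apply RInt_ge_subinterval; try lra.
  - intros z _; apply (continuous_scal_r (V := R_NormedModule)), Cg.
  - intros z _; apply Rmult_le_pos; [lra|apply Rlt_le, exp_pos].
  - intros z Hz; apply Rmult_le_compat; [lra|apply Rlt_le, exp_pos|lra|].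
    apply exp_nondecr; nra. }
assert (Ip := is_RInt_plus _ _ _ _ _ _
  (is_RInt_scal _ _ _ p _ Ih)
  (RInt_correct (V := R_CompleteNormedModule) (fun z => (1 - p) * g z) (- N) N
    (Ex _ (fun z => continuous_scal_r (V := R_NormedModule) _ _ _ (Cg z))))).
apply Rle_trans with
  (plus (scal p (2 * N * exp (- N ^ 2 / 32)))
    (RInt (fun z => (1 - p) * g z) (- N) N)).
{ unfold plus, scal; simpl; unfold mult; simpl.
  assert (E0 := exp_pos (- (N * (N * 1)) / 32)).
  assert (0 <= p * (2 * N * exp (- (N * (N * 1)) / 32)));
    [apply Rmult_le_pos; nra|lra]. }
refine (Rle_trans _ _ _ (Req_le _ _ (eq_sym (is_RInt_unique _ _ _ _ Ip))) _).
apply RInt_le; [lra|eexists; exact Ip|apply Ex, continuous_gauss_cos|].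
intros z _; unfold plus, scal; simpl; unfold mult; simpl.
unfold h, g, gauss_cos.
assert (E0 := exp_pos (- z ^ 2 / 32)).
assert (B := cos_ge_parabola (PI / 16 * z)).
apply (Rmult_le_compat_l (exp (- z ^ 2 / 32))) in B; [|lra].
eapply Rle_trans; [|exact B]; right; unfold p; field.
Qed.

Lemma is_lim_seq_exp_shift_0 (a : R) :
  is_lim_seq (fun n => exp (a - (INR n + 1))) 0.
Proof.
apply (is_lim_comp_seq exp _ m_infty 0); [apply is_lim_exp_m| |].
- exists O; easy.
- apply is_lim_seq_minus with a p_infty; [apply is_lim_seq_const| |reflexivity].
  apply is_lim_seq_plus with p_infty 1;
    [apply is_lim_seq_INR|apply is_lim_seq_const|reflexivity].
Qed.

Lemma is_lim_seq_exp_shift_p (a : R) :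
  is_lim_seq (fun n => exp (a + (INR n + 1))) p_infty.
Proof.
apply (is_lim_comp_seq exp _ p_infty p_infty); [apply is_lim_exp_p| |].
- exists O; easy.
- apply is_lim_seq_plus with a p_infty; [apply is_lim_seq_const| |reflexivity].
  apply is_lim_seq_plus with p_infty 1;
    [apply is_lim_seq_INR|apply is_lim_seq_const|reflexivity].
Qed.

(** The phase makes the moments with integer [s] vanish and leaves the growth
    [exp (8 s^2)] of the log-normal moments untouched elsewhere. *)
Lemma stieltjes_moment (beta mu : R) (s := mu + 1 - beta) :
  (sin (PI * s) = 0 -> power_pairing mu (stieltjes_fun beta) = RtoC 0) /\
  exp (- 1 / 32) * exp (8 * s ^ 2) * Rabs (sin (PI * s)) <=
    Cmod (power_pairing mu (stieltjes_fun beta)).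
Proof.
destruct (power_pairing_bound mu) as [K1 [K2 B]].
destruct (B _ (stieltjes_S_plus beta)) as [I _]; clear B K1 K2.
set (v := fun n => exp (8 * s ^ 2) * sin (PI * s) *
  RInt gauss_cos (- (INR n + 1)) (INR n + 1)).
assert (L : is_lim_seq (fun n => Cmod (RtoC (v n)))
  (Cmod (power_pairing mu (stieltjes_fun beta)))).
{ apply (is_half_line_integral_seq_Cmod _ _ _ _ _ I
    (fun n => exp_pos (16 * s - (INR n + 1)))
    (is_lim_seq_exp_shift_0 (16 * s)) (is_lim_seq_exp_shift_p (16 * s))).
  intros n; apply stieltjes_RInt. }
split.
- intros H0; apply Cmod_eq_0.
  apply is_lim_seq_unique in L; rewrite (Lim_seq_ext _ (fun _ => 0)) in L.
  + rewrite Lim_seq_const in L; now injection L.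
  + intros n; unfold v; rewrite H0, Rmult_0_r, Rmult_0_l; apply Cmod_0.
- refine (is_lim_seq_le _ _ (Finite _) (Finite _) _ (is_lim_seq_const _) L).
  intros n; rewrite Cmod_R; unfold v; rewrite !Rabs_mult.
  rewrite (Rabs_pos_eq (exp _)) by apply Rlt_le, exp_pos.
  assert (J := RInt_gauss_cos_lower_bound (INR n + 1)
    ltac:(assert (P := pos_INR n); lra)).
  rewrite Rmult_assoc, Rmult_comm; apply Rmult_le_compat_l.
  + apply Rmult_le_pos; [apply Rlt_le, exp_pos|apply Rabs_pos].
  + eapply Rle_trans; [exact J|apply Rle_abs].
Qed.

Lemma sin_PI_nat (n : nat) : sin (PI * INR n) = 0.
Proof.
induction n as [|n IH]; [now rewrite Rmult_0_r, sin_0|].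
rewrite S_INR, Rmult_plus_distr_l, Rmult_1_r, neg_sin, IH; ring.
Qed.

Lemma stieltjes_Phi_plus (beta : R) : Phi_plus beta (stieltjes_fun beta).
Proof.
split; [apply stieltjes_S_plus|]; intros k Hk.
destruct (power_pairing_bound (beta - INR k)) as [K1 [K2 B]].
destruct (B _ (stieltjes_S_plus beta)) as [I _]; clear B K1 K2.
rewrite (proj1 (stieltjes_moment beta (beta - INR k))) in I.
- revert I; apply is_half_line_integral_ext; intros t _; apply Cmult_comm.
- replace (PI * (beta - INR k + 1 - beta)) with (- (PI * (INR k - 1))) by ring.
  change 1 with (INR 1); rewrite <- minus_INR by exact Hk.
  rewrite sin_neg, sin_PI_nat; ring.
Qed.

Definition stieltjes_test (beta : R) : test_function beta :=
  Test_function beta (stieltjes_fun beta) (stieltjes_Phi_plus beta).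

(** * Lower bounds for the sine *)

Lemma sin_ge_third (u : R) : 0 <= u <= PI / 2 -> u / 3 <= sin u.
Proof.
intros Hu; assert (P4 := PI_4).
destruct (pre_sin_bound u 0) as [B _]; [lra|lra|].
apply Rle_trans with (2 := B); unfold sin_approx, sin_term; simpl.
assert (u ^ 2 <= 4) by (simpl; nra).
simpl in *; nra.
Qed.

Lemma Rabs_sin_ge_third (u : R) :
  Rabs u <= PI / 2 -> Rabs u / 3 <= Rabs (sin u).
Proof.
intros Hu; apply Rle_trans with (sin (Rabs u)).
- apply sin_ge_third; split; [apply Rabs_pos|exact Hu].
- unfold Rabs at 1; destruct (Rcase_abs u); [|apply Rle_abs].
  rewrite sin_neg, <- Rabs_Ropp; apply Rle_abs.
Qed.

Lemma Rabs_sin_add_PI (x : R) (n : nat) :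
  Rabs (sin (x + PI * INR n)) = Rabs (sin x).
Proof.
rewrite sin_plus, sin_PI_nat, Rmult_0_r, Rplus_0_r, Rabs_mult.
replace (Rabs (cos (PI * INR n))) with 1; [ring|].
assert (H := sin2_cos2 (PI * INR n)); rewrite sin_PI_nat in H.
unfold Rsqr in H; symmetry; rewrite <- sqrt_Rsqr_abs, <- sqrt_1; f_equal.
unfold Rsqr; lra.
Qed.

Lemma sin_irrational (alpha : R) (n : nat) : irrational alpha ->
  sin (PI * (INR n + 1) * alpha) <> 0.
Proof.
intros H E; apply sin_eq_0_0 in E; destruct E as [k E].
apply (H (k # Pos.of_succ_nat n)); unfold Q2R; simpl.
assert (P := PI_RGT_0); assert (Pn := pos_INR n).
assert (Z : IZR (Z.pos (Pos.of_succ_nat n)) = INR n + 1).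
{ rewrite <- S_INR, INR_IZR_INZ; f_equal. }
rewrite Z; apply Rmult_eq_reg_r with (PI * (INR n + 1)); [|nra].
transitivity (PI * (INR n + 1) * alpha); [ring|rewrite E; field; lra].
Qed.

(** Near the nearest integer [p] to [q alpha] the sine is comparable to
    [PI (q alpha - p)]; the polynomial rate in [q] is weakened to an
    exponential one, which [1 / Gamma] absorbs just as well. *)
Lemma poorly_approximated_sin (alpha : R) : 0 < alpha ->
  poorly_approximated alpha ->
  exists eps c : R, 0 < c /\ forall n : nat, 1 <= (INR n + 1) * alpha ->
    c * exp (- ((1 + eps) * (INR n + 1))) <=
      Rabs (sin (PI * (INR n + 1) * alpha)).
Proof.
intros Ha [eps [c [He [Hc H]]]]; exists eps, c; split; [exact Hc|].
intros n Hn; assert (Pn := pos_INR n).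
destruct (nfloor_ex ((INR n + 1) * alpha + 1 / 2)) as [p [Hp1 Hp2]]; [lra|].
assert (Hp : (0 < p)%nat).
{ destruct p; [simpl in Hp2; lra|lia]. }
specialize (H p (S n) Hp (Nat.lt_0_succ n)); rewrite S_INR in H.
set (q := INR n + 1) in *; assert (Hq : 1 <= q) by (unfold q; lra).
set (u := q * alpha - INR p).
assert (Hu : Rabs u <= 1 / 2) by (apply Rabs_le; unfold u; lra).
replace (PI * q * alpha) with (PI * u + PI * INR p) by (unfold u; ring).
rewrite Rabs_sin_add_PI.
assert (P3 := PI2_3_2).
assert (S : Rabs (PI * u) / 3 <= Rabs (sin (PI * u))).
{ apply Rabs_sin_ge_third; rewrite Rabs_mult, (Rabs_pos_eq PI) by lra; nra. }
rewrite Rabs_mult, (Rabs_pos_eq PI) in S by lra.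
assert (U0 := Rabs_pos u).
apply Rle_trans with (Rabs u); [|nra].
replace u with (q * (alpha - INR p / q)) by (unfold u; field; lra).
rewrite Rabs_mult, (Rabs_pos_eq q) by lra.
apply Rle_trans with (q * (c * Rpower q (-2 - eps))).
2: { apply Rmult_le_compat_l; [lra|exact H]. }
replace (q * (c * Rpower q (-2 - eps))) with (c * Rpower q (- (1 + eps))).
2: { replace (- (1 + eps)) with (1 + (-2 - eps)) by ring.
  rewrite Rpower_plus, Rpower_1 by lra; ring. }
apply Rmult_le_compat_l; [lra|]; unfold Rpower; apply exp_nondecr.
assert (L := ln_le_sub_1 q ltac:(lra)); nra.
Qed.

(** The subtraction formula for [a = (x + a) - x] bounds [|sin a|] by the sum
    of the two sines. *)
Lemma sin_consecutive (x a : R) :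
  Rabs (sin a) / 2 <= Rabs (sin x) \/ Rabs (sin a) / 2 <= Rabs (sin (x + a)).
Proof.
assert (E : sin a = sin (x + a) * cos x - cos (x + a) * sin x).
{ rewrite <- sin_minus; f_equal; ring. }
assert (T := Rabs_triang (sin (x + a) * cos x) (- (cos (x + a) * sin x))).
unfold Rminus in E; rewrite <- E, Rabs_Ropp, !Rabs_mult in T.
assert (C1 : Rabs (cos x) <= 1) by apply Rabs_le, COS_bound.
assert (C2 : Rabs (cos (x + a)) <= 1) by apply Rabs_le, COS_bound.
assert (S1 := Rabs_pos (sin x)); assert (S2 := Rabs_pos (sin (x + a))).
destruct (Rle_dec (Rabs (sin a) / 2) (Rabs (sin x))); [now left|right].
nra.
Qed.

(** * Pointwise convergence *)

Lemma Cmod_solution_coef (alpha : R) (lambda c0 : C) (n : nat) :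
  0 < alpha < 1 -> sin (PI * (INR n + 1) * alpha) <> 0 ->
  Cmod (solution_coef alpha lambda c0 n) =
    Cmod c0 * PI / Gamma (1 - alpha) *
      (Cmod lambda ^ n / Rabs (sin (PI * (INR n + 1) * alpha))) *
      / Gamma ((INR n + 1) * alpha).
Proof.
intros Ha Hs; assert (Pn := pos_INR n).
assert (G1 := Gamma_pos (1 - alpha) ltac:(lra)).
assert (G2 := Gamma_pos ((INR n + 1) * alpha) ltac:(nra)).
assert (P := PI_RGT_0).
assert (NZ : forall r, r <> 0 -> RtoC r <> RtoC 0).
{ intros r Hr E; apply Hr; now injection E. }
unfold solution_coef, Cdiv.
rewrite !Cmod_mult, !Cmod_inv, Cmod_pow, !Cmod_R by (apply NZ; lra).
rewrite (Rabs_pos_eq PI), (Rabs_pos_eq (Gamma (1 - alpha))),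
  (Rabs_pos_eq (Gamma ((INR n + 1) * alpha))) by lra.
reflexivity.
Qed.

Lemma solution_converges (alpha : R) (lambda c0 : C) (t : R) :
  0 < alpha < 1 -> poorly_approximated alpha -> 0 < t ->
  ex_series (K := C_AbsRing) (V := C_NormedModule)
    (solution_term alpha lambda c0 t).
Proof.
intros Ha Hpa Ht.
destruct (poorly_approximated_sin alpha (proj1 Ha) Hpa)
  as [eps [c [Hc Hsin]]].
destruct (nfloor_ex (/ alpha)) as [N [_ HN]].
{ apply Rlt_le, Rinv_0_lt_compat; lra. }
apply (ex_series_incr_n _ N).
(* [r] is the ratio of the terms without [1 / Gamma]; at [M] the lower bound
   for [Gamma] grows with ratio [2 (r + 1)]. *)
set (r := Cmod lambda * Rpower t (- alpha) * exp (1 + eps)).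
assert (Hr : 0 <= r).
{ repeat apply Rmult_le_pos; try (apply Rlt_le, exp_pos); apply Cmod_ge_0. }
set (M := Rpower (2 * (r + 1)) (/ alpha)).
assert (HM : Rpower M alpha = 2 * (r + 1)).
{ unfold M; rewrite Rpower_mult, Rinv_l, Rpower_1; lra. }
assert (M0 : 0 < M) by apply exp_pos.
set (K := Cmod c0 * PI / Gamma (1 - alpha)).
assert (G1 := Gamma_pos (1 - alpha) ltac:(lra)); assert (P := PI_RGT_0).
assert (HK : 0 <= K).
{ unfold K; apply Rdiv_le_0_compat; [|exact G1].
  apply Rmult_le_pos; [apply Cmod_ge_0|lra]. }
set (K' := K / c * exp (1 + eps) * exp (2 * M)).
apply (ex_series_le (V := C_CompleteNormedModule) _
  (fun k => K' * (1 / 2) ^ N * (1 / 2) ^ k)).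
2: { apply (ex_series_scal_l (K := R_AbsRing) (V := R_NormedModule)).
  apply ex_series_geom; rewrite Rabs_pos_eq; lra. }
intros k; change (Cmod (solution_term alpha lambda c0 t (N + k)) <=
  K' * (1 / 2) ^ N * (1 / 2) ^ k).
rewrite Rmult_assoc, <- pow_add; set (n := (N + k)%nat).
assert (Hn : INR N <= INR n) by (apply le_INR; unfold n; lia).
assert (Hna : 1 <= (INR n + 1) * alpha).
{ apply Rle_trans with (/ alpha * alpha); [rewrite Rinv_l; lra|].
  apply Rmult_le_compat_r; lra. }
specialize (Hsin n Hna); set (q := INR n + 1) in *.
assert (E0 : 0 < c * exp (- ((1 + eps) * q)))
  by (apply Rmult_lt_0_compat; [exact Hc|apply exp_pos]).
unfold solution_term.
rewrite Cmod_mult, Cmod_solution_coef, Cmod_R; [|exact Ha|].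
2: { intros E; fold q in E; rewrite E, Rabs_R0 in Hsin; lra. }
fold q K; rewrite (Rabs_pos_eq (Rpower _ _)) by apply Rlt_le, exp_pos.
assert (GL := Gamma_lower_bound M (q * alpha) M0 Hna).
assert (GE : Rpower M (q * alpha) = (2 * (r + 1)) ^ S n).
{ rewrite Rmult_comm, <- Rpower_mult, HM; unfold q.
  rewrite <- S_INR; apply Rpower_pow; lra. }
rewrite GE in GL; clear GE.
assert (R0 : 0 < (2 * (r + 1)) ^ S n) by (apply pow_lt; lra).
assert (GI : / Gamma (q * alpha) <= exp (2 * M) * / (2 * (r + 1)) ^ S n).
{ rewrite <- (Rinv_inv (exp (2 * M))), <- exp_Ropp, <- Rinv_mult.
  rewrite (Rmult_comm (exp _)); apply Rinv_le_contravar; [|exact GL].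
  apply Rmult_lt_0_compat; [exact R0|apply exp_pos]. }
assert (SI : / Rabs (sin (PI * q * alpha)) <= / c * exp ((1 + eps) * q)).
{ replace (exp ((1 + eps) * q)) with (/ exp (- ((1 + eps) * q))).
  2: { now rewrite exp_Ropp, Rinv_inv. }
  rewrite <- Rinv_mult; now apply Rinv_le_contravar. }
assert (L0 : 0 <= Cmod lambda ^ n) by (apply pow_le, Cmod_ge_0).
assert (T0 := Rpower_gt_0 t (- (INR n * alpha))).
assert (G2 := Gamma_pos (q * alpha) ltac:(lra)).
apply Rle_trans with (K * (Cmod lambda ^ n * (/ c * exp ((1 + eps) * q))) *
  (exp (2 * M) * / (2 * (r + 1)) ^ S n) * Rpower t (- (INR n * alpha))).
{ apply Rmult_le_compat_r; [lra|].
  assert (SI0 : 0 <= / Rabs (sin (PI * q * alpha))).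
  { apply Rlt_le, Rinv_0_lt_compat; lra. }
  apply Rmult_le_compat; [|now apply Rlt_le, Rinv_0_lt_compat| |exact GI].
  - unfold Rdiv; repeat (assumption || apply Rmult_le_pos).
  - apply Rmult_le_compat_l; [exact HK|]; now apply Rmult_le_compat_l. }
assert (En : Cmod lambda ^ n * Rpower t (- (INR n * alpha)) *
  exp ((1 + eps) * q) = r ^ n * exp (1 + eps)).
{ assert (Ep : forall x, exp x ^ n = exp (INR n * x)).
  { intros x; rewrite <- Rpower_pow by apply exp_pos.
    unfold Rpower; now rewrite ln_exp. }
  unfold r, Rpower, q; rewrite !Rpow_mult_distr, !Ep, !Rmult_assoc.
  f_equal; rewrite <- !exp_plus; f_equal; ring. }
replace (K * (Cmod lambda ^ n * (/ c * exp ((1 + eps) * q))) *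
  (exp (2 * M) * / (2 * (r + 1)) ^ S n) * Rpower t (- (INR n * alpha)))
  with (K * / c * exp (2 * M) * (Cmod lambda ^ n * Rpower t (- (INR n * alpha))
    * exp ((1 + eps) * q)) * / (2 * (r + 1)) ^ S n) by ring.
rewrite En.
replace (K * / c * exp (2 * M) * (r ^ n * exp (1 + eps)) *
  / (2 * (r + 1)) ^ S n) with (K' * (r ^ n * / (2 * (r + 1)) ^ S n))
  by (unfold K', Rdiv; ring).
apply Rmult_le_compat_l.
{ unfold K'; apply Rmult_le_pos; [|apply Rlt_le, exp_pos].
  apply Rmult_le_pos; [now apply Rdiv_le_0_compat|apply Rlt_le, exp_pos]. }
apply Rmult_le_reg_r with ((2 * (r + 1)) ^ S n); [exact R0|].
rewrite Rmult_assoc, Rinv_l, Rmult_1_r by lra.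
simpl pow; rewrite Rpow_mult_distr.
replace ((1 / 2) ^ n * (2 * (r + 1) * (2 ^ n * (r + 1) ^ n)))
  with ((1 / 2 * 2) ^ n * (2 * (r + 1) * (r + 1) ^ n))
  by (rewrite Rpow_mult_distr; ring).
replace (1 / 2 * 2) with 1 by field; rewrite pow1, Rmult_1_l.
assert (Q := pow_incr r (r + 1) n ltac:(lra)).
assert (Q0 := pow_le r n Hr); nra.
Qed.

(** * Weak divergence *)

Lemma dist_terms_lt_1 (beta : R) (T : nat -> distribution beta) :
  dist_series_converges_weakly beta T -> forall phi : test_function beta,
  exists N, forall n, (N <= n)%nat -> Cmod (T (S n) phi) < 1.
Proof.
intros H phi; destruct (H phi) as [l L].
set (nf := @norm_factor R_AbsRing C_R_NormedModule).
assert (Hnf : 0 < nf) by apply norm_factor_gt_0.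
assert (He : 0 < 1 / 2 / nf) by (apply Rdiv_lt_0_compat; lra).
destruct (L _ (locally_ball (T := C_R_NormedModule) l (mkposreal _ He)))
  as [N HN].
assert (B : forall n, (N <= n)%nat ->
  Cmod (Cminus (dist_partial_sum beta T n phi) l) < 1 / 2).
{ intros n Hn; specialize (HN n Hn).
  apply (norm_compat2 (V := C_R_NormedModule) _ _ (mkposreal _ He)) in HN.
  fold nf in HN; simpl in HN.
  replace (nf * (1 / 2 / nf)) with (1 / 2) in HN by (field; lra).
  rewrite <- Defs.Cmod_norm; exact HN. }
exists N; intros n Hn.
assert (B1 := B n Hn); assert (B2 := B (S n) ltac:(lia)); simpl in B2.
set (S1 := dist_partial_sum beta T n phi) in *.
replace (T (S n) phi) with
  (Cplus (Cminus (Cplus S1 (T (S n) phi)) l) (Copp (Cminus S1 l))) by ring.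
eapply Rle_lt_trans; [apply Cmod_triangle|]; rewrite Cmod_opp; lra.
Qed.

(** Against the test function, [exp (8 (n-1)^2 alpha^2)] from the moment beats
    [Gamma ((n+1) alpha) <= 1 + exp ((n+1)^2 alpha^2)] and [|lambda|^n]. *)
Lemma stieltjes_terms_large (alpha : R) (lambda c0 : C) (d : R) :
  0 < alpha < 1 -> irrational alpha ->
  lambda <> RtoC 0 -> c0 <> RtoC 0 -> 0 < d ->
  exists N : nat, forall n : nat, (N <= n)%nat ->
    d <= Rabs (sin (PI * INR n * alpha)) ->
    1 <= Cmod (solution_term_dist alpha lambda c0 (S n)
      (stieltjes_test (1 - alpha))).
Proof.
intros Ha Hirr Hl Hc Hd.
assert (L0 : 0 < Cmod lambda) by now apply Cmod_gt_0.
assert (C0 : 0 < Cmod c0) by now apply Cmod_gt_0.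
assert (G1 := Gamma_pos (1 - alpha) ltac:(lra)); assert (P := PI_RGT_0).
set (L := ln (Cmod lambda)).
set (K := Cmod c0 * PI / Gamma (1 - alpha)).
assert (HK : 0 < K).
{ unfold K; apply Rdiv_lt_0_compat; [nra|exact G1]. }
set (B := K * exp (- 1 / 32) * d).
assert (HB : 0 < B).
{ unfold B; apply Rmult_lt_0_compat; [|exact Hd].
  apply Rmult_lt_0_compat; [exact HK|apply exp_pos]. }
assert (A2 : 0 < alpha ^ 2) by (apply pow_lt; lra).
set (X := (8 * alpha ^ 2 + 2 * Rabs L + 3) / (7 * alpha ^ 2)).
assert (HX : 0 < X).
{ unfold X; apply Rdiv_lt_0_compat; [|lra].
  assert (Q := Rabs_pos L); lra. }
assert (Ia : 0 < / alpha) by (apply Rinv_0_lt_compat; lra).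
assert (IB : 0 < / B) by now apply Rinv_0_lt_compat.
destruct (INR_unbounded (1 + / alpha + / B + X + Rabs L)) as [N HN].
exists N; intros n Hn Hs; apply le_INR in Hn.
assert (LL := Rle_abs (- L)); rewrite Rabs_Ropp in LL.
assert (LA := Rabs_pos L).
set (m := INR n) in *.
assert (Hna : 1 <= (INR (S n) + 1) * alpha).
{ apply Rle_trans with (/ alpha * alpha); [rewrite Rinv_l; lra|].
  rewrite S_INR; fold m; apply Rmult_le_compat_r; lra. }
change (1 <= Cmod (Cmult (solution_coef alpha lambda c0 (S n))
  (power_pairing (- (INR (S n) * alpha)) (stieltjes_fun (1 - alpha))))).
rewrite Cmod_mult, Cmod_solution_coef; [|exact Ha|now apply sin_irrational].
assert (Hs0 := sin_irrational alpha (S n) Hirr).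
destruct (Gamma_large _ Hna) as [_ GU].
assert (G2 := Gamma_pos ((INR (S n) + 1) * alpha) ltac:(lra)).
destruct (stieltjes_moment (1 - alpha) (- (INR (S n) * alpha))) as [_ ML].
cbv zeta in ML.
replace (- (INR (S n) * alpha) + 1 - (1 - alpha)) with (- (m * alpha)) in ML
  by (rewrite S_INR; unfold m; ring).
replace (PI * - (m * alpha)) with (- (PI * m * alpha)) in ML by ring.
rewrite sin_neg, Rabs_Ropp in ML.
set (pp := Cmod (power_pairing _ _)) in *.
set (G := Gamma ((INR (S n) + 1) * alpha)) in *.
set (s := Rabs (sin (PI * (INR (S n) + 1) * alpha))).
assert (S0 : 0 < s) by now apply Rabs_pos_lt.
assert (S1 : s <= 1) by apply Rabs_le, SIN_bound.
fold K.
assert (GU' : G <= exp (((m + 2) * alpha) ^ 2 + 1)).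
{ replace (INR (S n) + 1) with (m + 2) in GU by (rewrite S_INR; unfold m; ring).
  assert (E1 : 1 <= exp (((m + 2) * alpha) ^ 2)).
  { rewrite <- exp_0; apply exp_nondecr, pow2_ge_0. }
  assert (E2 := exp_ineq1_le 1); rewrite exp_plus; nra. }
assert (Lp : Cmod lambda ^ S n = exp ((m + 1) * L)).
{ rewrite <- Rpower_pow, S_INR by exact L0; reflexivity. }
assert (Hexp : m + 1 <= (m + 1) * L + 8 * (- (m * alpha)) ^ 2 -
  (((m + 2) * alpha) ^ 2 + 1)).
{ assert (HXm : 8 * alpha ^ 2 + 2 * Rabs L + 3 <= 7 * alpha ^ 2 * m).
  { replace (8 * alpha ^ 2 + 2 * Rabs L + 3) with (7 * alpha ^ 2 * X)
      by (unfold X; field; lra).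
    apply Rmult_le_compat_l; lra. }
  assert (Hm : 1 <= m) by lra.
  apply (Rmult_le_compat_l m) in HXm; [|lra].
  assert (Q1 : (m + 1) * - L <= (m + 1) * Rabs L)
    by (apply Rmult_le_compat_l; lra).
  assert (Q2 : 1 * Rabs L <= m * Rabs L) by (apply Rmult_le_compat_r; lra).
  assert (Q3 : 1 * alpha ^ 2 <= m * alpha ^ 2)
    by (apply Rmult_le_compat_r; lra).
  nra. }
assert (Hm : 0 <= m) by apply pos_INR.
assert (PP : exp (- 1 / 32) * exp (8 * (- (m * alpha)) ^ 2) * d <= pp).
{ eapply Rle_trans; [|exact ML]; apply Rmult_le_compat_l; [|exact Hs].
  apply Rmult_le_pos; apply Rlt_le, exp_pos. }
assert (GI : exp (- (((m + 2) * alpha) ^ 2 + 1)) <= / G).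
{ rewrite exp_Ropp; apply Rinv_le_contravar; assumption. }
assert (SI : exp ((m + 1) * L) <= Cmod lambda ^ S n / s).
{ rewrite Lp; apply Rmult_le_reg_r with s; [exact S0|].
  unfold Rdiv; rewrite Rmult_assoc, Rinv_l by lra.
  assert (Q := exp_pos ((m + 1) * L)); nra. }
apply Rle_trans with (B * exp (m + 1)).
{ assert (Q := exp_ineq1_le (m + 1)).
  apply Rle_trans with (B * / B); [rewrite Rinv_r; lra|].
  apply Rmult_le_compat_l; lra. }
apply Rle_trans with (B * exp ((m + 1) * L + 8 * (- (m * alpha)) ^ 2 -
  (((m + 2) * alpha) ^ 2 + 1))).
{ apply Rmult_le_compat_l; [lra|now apply exp_nondecr]. }
unfold Rminus; rewrite !exp_plus.
replace (B * _) with (K * exp ((m + 1) * L) *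
  exp (- (((m + 2) * alpha) ^ 2 + 1)) *
  (exp (- 1 / 32) * exp (8 * (- (m * alpha)) ^ 2) * d))
  by (unfold B; ring).
assert (Ke : 0 <= K * exp ((m + 1) * L)).
{ apply Rmult_le_pos; [lra|apply Rlt_le, exp_pos]. }
apply Rmult_le_compat; [| | |exact PP].
- apply Rmult_le_pos; [exact Ke|apply Rlt_le, exp_pos].
- apply Rmult_le_pos; [|lra]; apply Rmult_le_pos; apply Rlt_le, exp_pos.
- apply Rmult_le_compat; [exact Ke|apply Rlt_le, exp_pos| |exact GI].
  apply Rmult_le_compat_l; [lra|exact SI].
Qed.

Lemma solution_diverges (alpha : R) (lambda c0 : C) :
  0 < alpha < 1 -> irrational alpha ->
  lambda <> RtoC 0 -> c0 <> RtoC 0 ->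
  ~ dist_series_converges_weakly (1 - alpha)
      (solution_term_dist alpha lambda c0).
Proof.
intros Ha Hirr Hl Hc H.
destruct (dist_terms_lt_1 _ _ H (stieltjes_test (1 - alpha))) as [N1 H1].
assert (Hs : sin (PI * alpha) <> 0).
{ assert (Q := sin_irrational alpha 0 Hirr); simpl in Q.
  now rewrite Rplus_0_l, Rmult_1_r in Q. }
apply Rabs_pos_lt in Hs.
destruct (stieltjes_terms_large alpha lambda c0
  (Rabs (sin (PI * alpha)) / 2) Ha Hirr Hl Hc) as [N2 H2]; [lra|].
assert (Large : exists n, (N1 <= n)%nat /\ (N2 <= n)%nat /\
  Rabs (sin (PI * alpha)) / 2 <= Rabs (sin (PI * INR n * alpha))).
{ set (n := max N1 N2).
  destruct (sin_consecutive (PI * INR n * alpha) (PI * alpha)) as [E|E].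
  - exists n; repeat split; [lia|lia|exact E].
  - exists (S n); repeat split; [lia|lia|].
    rewrite S_INR; replace (PI * (INR n + 1) * alpha)
      with (PI * INR n * alpha + PI * alpha) by ring; exact E. }
destruct Large as [n [Hn1 [Hn2 Hsin]]].
specialize (H1 n Hn1); specialize (H2 n Hn2 Hsin); lra.
Qed.

Theorem theorem3 (alpha : R) (lambda c0 : C)
  (halpha : 0 < alpha < 1) (hirr : irrational alpha)
  (hlambda : lambda <> RtoC 0) (hc0 : c0 <> RtoC 0) :
  (poorly_approximated alpha ->
     forall t : R, 0 < t ->
       ex_series (K := C_AbsRing) (V := C_NormedModule)
         (solution_term alpha lambda c0 t)) /\
  ~ dist_series_converges_weakly (1 - alpha)
      (solution_term_dist alpha lambda c0).
Proof.
split.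
- intros Hpa t Ht; now apply solution_converges.
- now apply solution_diverges.
Qed.
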